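(* Let $\mathcal{C}(\mathcal{Z})$ be the discrete cluster category associated to an admissible subset $\mathcal{Z}\subseteq S^1$ with limit points $a_1<\dots<a_n$. There is a one-to-one correspondence $$\{\overline{\mathcal{Z}}\text{-decorated non-crossing partitions of }[n]\}\to\{\text{t-structures of }\mathcal{C}(\mathcal{Z})\}.$$ It sends a $\overline{\mathcal{Z}}$-decorated non-crossing partition $(\mathcal{P},\mathbf{x})$, $\mathbf{x}=(x_1,\ldots,x_n)$, to the t-structure with aisle $$\mathcal{X}(\mathcal{P},\mathbf{x})=\mathrm{add}\,\Big\{\{y_0,y_1\}\text{ arc of }\mathcal{Z}\;\Big|\; y_0,y_1\in\bigcup_{i\in B}(a_i,x_i]\text{ for some }B\in\mathcal{P}\Big\}.$$
   Context: **Combinatorial setting.** $\mathbb{K}$ is a field. $S^1$ is the unit circle with anti-clockwise cyclic order: for pairwise distinct $x,y,z\in S^1$, $x<y<z$ means that going anti-clockwise one meets first $x$, then $y$, then $z$; for $m\ge 3$, $x_1<\dots<x_m$ means $x_i<x_{i+1}<x_{i+2}$ for all $i$ (indices modulo $m$). $\mathcal{Z}\subseteq S^1$ is admissible: discrete, infinite, with set of limit points $L(\mathcal{Z})=\overline{\mathcal{Z}}\setminus\mathcal{Z}$ ($\overline{\mathcal{Z}}$ the topological closure) finite of cardinality $n\geq 1$, every limit point being a two-sided limit point. The limit points are $a_1<\dots<a_n$, indices modulo $n$ (so $a_{n+1}=a_1$). For $a,b\in\overline{\mathcal{Z}}$, $(a,b)=\{c\in\overline{\mathcal{Z}}\mid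 a<c<b\}$, and $[a,b],[a,b),(a,b]$ are defined analogously as subsets of $\overline{\mathcal{Z}}$. Each $z\in\mathcal{Z}$ has an immediate successor $z^+$ and predecessor $z^-$ in $\mathcal{Z}$ (anti-clockwise, resp. clockwise neighbour). An arc of $\mathcal{Z}$ is a 2-element subset $\{z_0,z_1\}\subseteq\mathcal{Z}$ with $z_1\notin\{z_0^-,z_0,z_0^+\}$. Arcs $\{y_0,y_1\},\{y_0',y_1'\}$ cross if $y_0<y_0'<y_1<y_1'$ or $y_0<y_1'<y_1<y_0'$. **The category.** $\mathcal{C}(\mathcal{Z})$ is the discrete cluster category of Igusa–Todorov: a $\mathbb{K}$-linear, 2-Calabi–Yau, Krull–Schmidt triangulated category with suspension $\Sigma$ whose non-zero indecomposable objects correspond to arcs of $\mathcal{Z}$ (same notation for arc and object), with: - $\Sigma\{y_0,y_1\}=\{y_0^-,y_1^-\}$; - $\mathrm{Hom}(\{y_0,y_1\},\Sigma\{y_0',y_1'\})=\mathbb{K}$ if the arcs $\{y_0,y_1\}$ and $\{y'_0,y'_1\}$ cross, and $0$ otherwise; - a non-zero morphism $\{y_0,y_1\}\to\{y_0',y_1'\}$ with $y_0<y_0'^+<y_1<y_1'^+$ factors through an indecomposable $S$ iff $S=\{s_0,s_1\}$ with $y_0\le s_0\le y_0'$ and $y_1\le s_1\le y_1'$; - if $y_0<y_0'<y_1<y_1'$, every non-zero $f:\{y_0,y_1\}\to\Sigma\{y_0',y_1'\}$ sits in a triangle $\{y_0',y_1'\}\to X\oplus Z\to\{y_0,y_1\}\xrightarrow{f}\Sigma\{y_0',y_1'\}$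 with $X=\{y_0,y_0'\}$, $Z=\{y_1,y_1'\}$ (read as $0$ when not an arc); the components of the first two maps to and from $X$, $Z$ are non-zero when the corresponding objects are non-zero. All subcategories are full and closed under direct sums and summands; $\mathrm{add}(\mathcal{Y})$ is the smallest such subcategory containing the set of arcs $\mathcal{Y}$. **t-structures.** A torsion pair in a triangulated category $\mathcal{T}$ is a pair $(\mathcal{X},\mathcal{Y})$ of subcategories closed under direct summands with $\mathrm{Hom}(X,Y)=0$ for $X\in\mathcal{X},Y\in\mathcal{Y}$ and such that every $T\in\mathcal{T}$ has a distinguished triangle $X\to T\to Y\to\Sigma X$ with $X\in\mathcal{X},Y\in\mathcal{Y}$. A t-structure is a torsion pair with $\Sigma\mathcal{X}\subseteq\mathcal{X}$; $\mathcal{X}$ is its aisle, $\mathcal{Y}=\mathcal{X}^\perp$ its coaisle. A t-structure is determined by its aisle. **Decorated partitions.** A non-crossing partition $\mathcal{P}=\{B_m\mid m\in I\}$ of $[n]=\{1,\dots,n\}$ is a partition of $[n]$ into non-empty blocks such that whenever $i<k<j<l$ with $i,j\in B_{m_1}$, $k,l\in B_{m_2}$, then $m_1=m_2$. $i$ is a singleton of $\mathcal{P}$ if $\{i\}\in\mathcal{P}$; $i$ is an adjacency of $\mathcal{P}$ if $i$ and $i+1$ (cyclically modulo $n$) are in the same block. A $\overline{\mathcal{Z}}$-decoration of $\mathcal{P}$ is a tuple $\mathbf{x}=(x_1,\ldots,x_n)$ with $x_i\in[a_i,a_{i+1})$ if $i$ is a singleton, $x_i\in(a_i,a_{i+1}]$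 if $i$ is an adjacency, and $x_i\in(a_i,a_{i+1})$ otherwise. The pair $(\mathcal{P},\mathbf{x})$ is a $\overline{\mathcal{Z}}$-decorated non-crossing partition. If $x_i=a_i$ for a singleton $i$, then $(a_i,x_i]=\varnothing$. **Convention for $n=1$.** Here $1$ counts as both a singleton and an adjacency of the unique partition of $[1]$, and the circle is cut open at the limit point: $x_1$ is either an element of $\mathcal{Z}$, or the formal left endpoint $a_1$ (with $(a_1,x_1]=\varnothing$), or the formal right endpoint $a_2$ (with $(a_1,x_1]\cap\mathcal{Z}=\mathcal{Z}$), the two endpoints being regarded as distinct decorations. *)

(* Defs.v *)
From HB Require Import structures.
From mathcomp Require Import all_boot all_order all_algebra.
From mathcomp Require Import all_classical all_reals all_analysis.
Set Implicit Arguments.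
Unset Strict Implicit.
Unset Printing Implicit Defensive.
Import Order.TTheory GRing.Theory Num.Theory.
Import numFieldNormedType.Exports.
Local Open Scope classical_set_scope.
Local Open Scope ring_scope.

(** * Linear and triangulated categories *)

Record linear_category (K : fieldType) := LinearCategory {
  object :> Type;
  Mor : object -> object -> lmodType K;
  idm : forall X, Mor X X;
  compose : forall X Y W, Mor Y W -> Mor X Y -> Mor X W;
  composeA : forall X Y W V (h : Mor W V) (g : Mor Y W) (f : Mor X Y),
    compose h (compose g f) = compose (compose h g) f;
  compose1m : forall X Y (f : Mor X Y), compose (idm Y) f = f;
  composem1 : forall X Y (f : Mor X Y), compose f (idm X) = f;
  compose_linearl : forall X Y W (f : Mor X Y),
    linear (fun g : Mor Y W => compose g f);
  compose_linearr : forall X Y W (g : Mor Y W),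
    linear (fun f : Mor X Y => compose g f)
}.
Arguments Mor {K l} X Y.
Arguments idm {K l} X.
Arguments compose {K l X Y W} g f.

Notation "g \oc f" := (compose g f) (at level 40, left associativity).

Section LinearCategory.
Context {K : fieldType} {C : linear_category K}.
Implicit Types X Y W S : C.

Definition is_iso X Y (f : Mor X Y) :=
  exists g : Mor Y X, g \oc f = idm X /\ f \oc g = idm Y.

Definition isomorphic X Y := exists f : Mor X Y, is_iso f.

Definition is_zero X := idm X = 0.

Definition is_biproduct X Y S (i1 : Mor X S) (i2 : Mor Y S)
    (p1 : Mor S X) (p2 : Mor S Y) :=
  [/\ p1 \oc i1 = idm X, p2 \oc i2 = idm Y, p1 \oc i2 = 0, p2 \oc i1 = 0
    & i1 \oc p1 + i2 \oc p2 = idm S].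

Definition direct_sum2 X Y S := exists i1 i2 p1 p2, @is_biproduct X Y S i1 i2 p1 p2.

(* For m = 0 this says that S is a zero object *)
Definition direct_sum (m : nat) (X : 'I_m -> C) S :=
  exists (i : forall k, Mor (X k) S) (p : forall k, Mor S (X k)),
  [/\ forall k, p k \oc i k = idm (X k),
      forall j k, j != k -> p j \oc i k = 0
    & \sum_k i k \oc p k = idm S].

Definition indecomposable S :=
  ~ is_zero S /\ forall X Y, direct_sum2 X Y S -> is_zero X \/ is_zero Y.

Definition local_endomorphism_ring X :=
  ~ is_zero X /\ forall f : Mor X X, is_iso f \/ is_iso (idm X - f).

Definition krull_schmidt := forall S, exists (m : nat) (X : 'I_m -> C),
  direct_sum X S /\ forall k, local_endomorphism_ring (X k).

(* Full subcategories are represented by their sets of objects.  Closure under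
   isomorphism follows from closure under summands (take a zero complement). *)
Definition is_subcategory (U : set C) :=
  (forall m (X : 'I_m -> C) S, direct_sum X S -> (forall k, U (X k)) -> U S) /\
  (forall X Y S, direct_sum2 X Y S -> U S -> U X).

Definition add_closure (G : set C) : set C :=
  [set X | forall U, is_subcategory U -> G `<=` U -> U X].

End LinearCategory.
Arguments krull_schmidt {K} C.

Record triangle_data (K : fieldType) := TriangleData {
  tcat :> linear_category K;
  susp : tcat -> tcat;
  suspm : forall X Y : tcat, Mor X Y -> Mor (susp X) (susp Y);
  dist : forall X Y W : tcat, Mor X Y -> Mor Y W -> Mor W (susp X) -> Prop
}.
Arguments susp {K t} X.
Arguments suspm {K t X Y} f.
Arguments dist {K t X Y W} f g h.

Record triangulated (K : fieldType) (C : triangle_data K) : Prop := Triangulated {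
  has_zero : exists O : C, is_zero O;
  has_sums : forall X Y : C, exists S, direct_sum2 X Y S;
  (* the suspension is a K-linear autoequivalence *)
  suspm_id : forall X : C, suspm (idm X) = idm (susp X);
  suspm_comp : forall (X Y W : C) (g : Mor Y W) (f : Mor X Y),
    suspm (g \oc f) = suspm g \oc suspm f;
  suspm_linear : forall X Y : C, linear (fun f : Mor X Y => suspm f);
  suspm_ff : forall X Y : C, bijective (fun f : Mor X Y => suspm f);
  susp_es : forall Y : C, exists X : C, isomorphic (susp X) Y;
  (* TR1 *)
  dist_iso : forall (X Y W X' Y' W' : C)
      (f : Mor X Y) (g : Mor Y W) (h : Mor W (susp X))
      (f' : Mor X' Y') (g' : Mor Y' W') (h' : Mor W' (susp X'))
      (a : Mor X X') (b : Mor Y Y') (c : Mor W W'),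
    is_iso a -> is_iso b -> is_iso c ->
    b \oc f = f' \oc a -> c \oc g = g' \oc b -> suspm a \oc h = h' \oc c ->
    dist f g h -> dist f' g' h';
  dist_id : forall X O : C, is_zero O ->
    dist (idm X) (0 : Mor X O) (0 : Mor O (susp X));
  dist_cone : forall (X Y : C) (f : Mor X Y),
    exists (W : C) (g : Mor Y W) (h : Mor W (susp X)), dist f g h;
  (* TR2 *)
  dist_rot : forall (X Y W : C) (f : Mor X Y) (g : Mor Y W) (h : Mor W (susp X)),
    dist f g h <-> dist g h (- suspm f);
  (* TR3 *)
  dist_fill : forall (X Y W X' Y' W' : C)
      (f : Mor X Y) (g : Mor Y W) (h : Mor W (susp X))
      (f' : Mor X' Y') (g' : Mor Y' W') (h' : Mor W' (susp X'))
      (a : Mor X X') (b : Mor Y Y'),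
    dist f g h -> dist f' g' h' -> b \oc f = f' \oc a ->
    exists c : Mor W W', c \oc g = g' \oc b /\ suspm a \oc h = h' \oc c;
  (* TR4, the octahedral axiom *)
  dist_octahedron : forall (X Y V A B D : C) (f : Mor X Y) (g : Mor Y V)
      (f1 : Mor Y A) (f2 : Mor A (susp X))
      (g1 : Mor V B) (g2 : Mor B (susp Y))
      (h1 : Mor V D) (h2 : Mor D (susp X)),
    dist f f1 f2 -> dist g g1 g2 -> dist (g \oc f) h1 h2 ->
    exists (u : Mor A D) (v : Mor D B),
      [/\ dist u v (suspm f1 \oc g2),
          u \oc f1 = h1 \oc g, h2 \oc u = f2,
          v \oc h1 = g1 & g2 \oc v = suspm f \oc h2]
}.

Section Triangulated.
Context {K : fieldType} (C : triangle_data K).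

Definition hom_finite := forall X Y : C,
  exists (m : nat) (f : {linear Mor X Y -> 'rV[K]_m}), bijective f.

(* The natural isomorphism Hom(X, Y) ~ D Hom(Y, Sigma^2 X) is given as a
   pairing that is perfect and natural in X and Y. *)
Definition calabi_yau2 :=
  hom_finite /\
  exists pair : forall X Y : C, Mor X Y -> Mor Y (susp (susp X)) -> K,
  [/\ forall (X Y : C) (u : Mor Y (susp (susp X))),
        scalar (fun f : Mor X Y => pair X Y f u),
      forall (X Y : C) (f : Mor X Y),
        scalar (fun u : Mor Y (susp (susp X)) => pair X Y f u),
      forall (X Y : C) (phi : {scalar Mor Y (susp (susp X))}),
        exists! f : Mor X Y, forall u, phi u = pair X Y f u
    & forall (X' X Y Y' : C) (h : Mor X' X) (f : Mor X Y) (g : Mor Y Y')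
        (u : Mor Y' (susp (susp X'))),
        pair X' Y' (g \oc f \oc h) u =
        pair X Y f (suspm (suspm h) \oc u \oc g)].

Definition torsion_pair (U V : set C) :=
  [/\ is_subcategory U, is_subcategory V,
      forall X Y, U X -> V Y -> forall f : Mor X Y, f = 0
    & forall T : C, exists (X Y : C)
        (f : Mor X T) (g : Mor T Y) (h : Mor Y (susp X)),
        [/\ U X, V Y & dist f g h]].

Definition t_structure (U V : set C) :=
  torsion_pair U V /\ forall X, U X -> U (susp X).

End Triangulated.

(** * The circle, admissible sets and arcs *)

Notation plane R := (R * R)%type (only parsing).

Section Circle.
Context {R : realType}.
Implicit Types x y z w p : plane R.

Definition circle_pt (t : R) : plane R := (cos t, sin t).

Definition unit_circle : set (plane R) := [set p | p.1 ^+ 2 + p.2 ^+ 2 = 1].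

(* x < y < z in the anti-clockwise cyclic order; in particular the three points
   are on the unit circle and pairwise distinct. *)
Definition cyc x y z := exists s t u : R,
  [/\ s < t, t < u, u < s + pi *+ 2
    & [/\ x = circle_pt s, y = circle_pt t & z = circle_pt u]].

Definition cyc4 x y z w := [/\ cyc x y z, cyc y z w, cyc z w x & cyc w x y].

Variable Z : set (plane R).

Definition limit_pts : set (plane R) := closure Z `\` Z.

Definition two_sided p := forall y, unit_circle y -> y <> p ->
  (exists2 z, Z z & cyc p z y) /\ (exists2 z, Z z & cyc y z p).

Definition admissible (n : nat) :=
  [/\ Z `<=` unit_circle, forall z, Z z -> isolated Z z, infinite_set Z,
      (limit_pts #= `I_n)%card & forall p, limit_pts p -> two_sided p].

(* a_1 < ... < a_n are the limit points: one full turn, so that the cyclic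
   inequalities hold for all triples of indices in increasing order. *)
Definition limit_enumeration (n : nat) (a : 'I_n -> plane R) :=
  [/\ injective a, range a = limit_pts
    & forall i j k : 'I_n, (i < j)%N -> (j < k)%N -> cyc (a i) (a j) (a k)].

(* Intervals in the closure of Z.  For x = y, [x, y] is {x} and the other
   three are empty. *)
Definition ivoo x y : set (plane R) := [set c | closure Z c /\ cyc x c y].
Definition ivcc x y : set (plane R) := ivoo x y `|` [set x; y].
Definition ivco x y : set (plane R) := ivcc x y `\ y.
Definition ivoc x y : set (plane R) := ivcc x y `\ x.

Definition next_to z w :=
  [/\ Z z, Z w, z <> w & forall c, Z c -> ~ cyc z c w].

Definition zsucc z : plane R := xget z [set w | next_to z w].
Definition zpred z : plane R := xget z [set w | next_to w z].

Definition is_arc (A : set (plane R)) := exists z0 z1,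
  [/\ Z z0, Z z1, ~ [set zpred z0; z0; zsucc z0] z1 & A = [set z0; z1]].

Definition crossing y0 y1 y0' y1' := cyc4 y0 y0' y1 y1' \/ cyc4 y0 y1' y1 y0'.

End Circle.

(** * The discrete cluster category *)

(* [E A] is the indecomposable object corresponding to the arc A, and a zero
   object when A is not an arc. *)
Record discrete_cluster_category (R : realType) (K : fieldType)
    (Z : set (plane R)) (C : triangle_data K) (E : set (plane R) -> C) : Prop :=
  DiscreteClusterCategory {
  dcc_triangulated : triangulated C;
  dcc_krull_schmidt : krull_schmidt C;
  dcc_calabi_yau : calabi_yau2 C;
  dcc_indec : forall A, is_arc Z A -> indecomposable (E A);
  dcc_indec_arc : forall S : C, indecomposable S ->
    exists2 A, is_arc Z A & isomorphic (E A) S;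
  dcc_inj : forall A B, is_arc Z A -> is_arc Z B ->
    isomorphic (E A) (E B) -> A = B;
  dcc_zero : forall A, ~ is_arc Z A -> is_zero (E A);
  dcc_susp : forall y0 y1, is_arc Z [set y0; y1] ->
    isomorphic (susp (E [set y0; y1])) (E [set zpred Z y0; zpred Z y1]);
  dcc_hom1 : forall y0 y1 y0' y1',
    is_arc Z [set y0; y1] -> is_arc Z [set y0'; y1'] ->
    crossing y0 y1 y0' y1' ->
    exists f : {scalar Mor (E [set y0; y1]) (susp (E [set y0'; y1']))},
      bijective f;
  dcc_hom0 : forall y0 y1 y0' y1',
    is_arc Z [set y0; y1] -> is_arc Z [set y0'; y1'] ->
    ~ crossing y0 y1 y0' y1' ->
    forall f : Mor (E [set y0; y1]) (susp (E [set y0'; y1'])), f = 0;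
  dcc_factor : forall y0 y1 y0' y1',
    is_arc Z [set y0; y1] -> is_arc Z [set y0'; y1'] ->
    cyc4 y0 (zsucc Z y0') y1 (zsucc Z y1') ->
    forall f : Mor (E [set y0; y1]) (E [set y0'; y1']), f <> 0 ->
    forall S, is_arc Z S ->
    ((exists (g : Mor (E S) (E [set y0'; y1'])) (h : Mor (E [set y0; y1]) (E S)),
        f = g \oc h) <->
     (exists s0 s1,
        [/\ S = [set s0; s1], ivcc Z y0 y0' s0 & ivcc Z y1 y1' s1]));
  dcc_triangle : forall y0 y1 y0' y1',
    is_arc Z [set y0; y1] -> is_arc Z [set y0'; y1'] ->
    cyc4 y0 y0' y1 y1' ->
    forall f : Mor (E [set y0; y1]) (susp (E [set y0'; y1'])), f <> 0 ->
    exists (M : C)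
      (i1 : Mor (E [set y0; y0']) M) (i2 : Mor (E [set y1; y1']) M)
      (p1 : Mor M (E [set y0; y0'])) (p2 : Mor M (E [set y1; y1']))
      (u : Mor (E [set y0'; y1']) M) (v : Mor M (E [set y0; y1])),
      [/\ is_biproduct i1 i2 p1 p2, dist u v f,
          is_arc Z [set y0; y0'] -> p1 \oc u <> 0 /\ v \oc i1 <> 0
        & is_arc Z [set y1; y1'] -> p2 \oc u <> 0 /\ v \oc i2 <> 0]
}.

(** * Decorated non-crossing partitions *)

(* The entries of a decoration: a point of the closure of Z, or, when n = 1
   only, the formal right endpoint a_2 (the point a_1 then stands for the left
   endpoint). *)
Inductive entry (R : realType) := Pt of plane R | RightEnd.
Arguments RightEnd {R}.

(* [n] is represented by 'I_n; the cyclic successor i + 1 is [ordS i]. *)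
Section Partition.
Context {R : realType} (Z : set (plane R)) {n : nat} (a : 'I_n -> plane R).
Implicit Types (P : {set {set 'I_n}}) (x : {ffun 'I_n -> entry R}).

Definition non_crossing P :=
  finset.partition P [set: 'I_n]%SET /\
  forall (B1 B2 : {set 'I_n}) (i k j l : 'I_n), B1 \in P -> B2 \in P ->
    (i < k)%N -> (k < j)%N -> (j < l)%N ->
    i \in B1 -> j \in B1 -> k \in B2 -> l \in B2 -> B1 = B2.

Definition singleton P (i : 'I_n) : bool := [set i]%SET \in P.

Definition adjacency P (i : 'I_n) : bool :=
  [exists B in P, (i \in B) && (ordS i \in B)].

Definition entry_range P (i : 'I_n) : set (plane R) :=
  if singleton P i then ivco Z (a i) (a (ordS i))
  else if adjacency P i then ivoc Z (a i) (a (ordS i))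
  else ivoo Z (a i) (a (ordS i)).

Definition decoration P x := forall i,
  match x i with
  | Pt p => if n == 1%N then Z p \/ p = a i else entry_range P i p
  | RightEnd => n = 1%N
  end.

Definition decorated_ncp : set ({set {set 'I_n}} * {ffun 'I_n -> entry R}) :=
  [set Px | non_crossing Px.1 /\ decoration Px.1 Px.2].

(* (a_i, x_i]; only its points in Z matter, and for the formal right endpoint
   these are all of Z. *)
Definition half_open (i : 'I_n) (e : entry R) : set (plane R) :=
  match e with Pt p => ivoc Z (a i) p | RightEnd => Z end.

Definition aisle_arcs P x : set (set (plane R)) :=
  [set A | is_arc Z A /\ exists2 B, B \in P &
    A `<=` \bigcup_(i in [set` B]) half_open i (x i)].

End Partition.

(* Main.v *)
(** Cutting the circle at [a_1] turns [Z] into n copies of the integers in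
    lexicographic order, the successor being [k |-> k + 1] in each copy.

    Aisles from decorations: let [T = {t0, t1}] be an arc.  A block [B] whose
    region (the union of its [(a_i, x_i]]) meets both [[t1^++, t0]] and
    [[t0^++, t1]] has last points [s0], [s1] there, because an interval that
    reaches its right limit point belongs to an adjacency.  Every map from an
    arc of [B] to [T] factors through [S_B = {s0, s1}], a non-zero map from an
    arc of [B] to [Sigma S_B] stays non-zero in [Sigma T], and arcs of different
    blocks do not cross.  Hence the cone of the sum of the [S_B -> T] is right
    orthogonal to the aisle.

    Decorations from aisles: the arcs of an aisle are closed under [Sigma] and,
    when two of them cross, under passing to the sides of the quadrilateral.
    This forces them to be all the arcs between linked, downward closed parts of
    the copies of the integers, linking being a non-crossing equivalence.  If
    the part of [(a_i, a_(i+1))] is everything, then approximating an arc from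
    this segment to the next one by finitely many arcs of the aisle shows that
    the two segments are linked.

    Injectivity: the identity of an arc factors through no other arc. *)
Require Import Defs.
From HB Require Import structures.
From mathcomp Require Import all_boot all_order all_algebra.
From mathcomp Require Import all_classical all_reals all_analysis.
From mathcomp Require Import zify ring lra.
Set Implicit Arguments.
Unset Strict Implicit.
Unset Printing Implicit Defensive.
Import Order.TTheory GRing.Theory Num.Theory.
Import numFieldNormedType.Exports.
Local Open Scope classical_set_scope.
Local Open Scope ring_scope.

(** * Linear categories *)

(** Maps into an arc are extensions in disguise: Hom(Y, T) is Hom(Y, Sigma T') for T' = {t0^+,
    t1^+}, so it is non-zero exactly when Y crosses T'. With the endpoints of Y suitably named this
    says that y0 lies in [t1^++, t0] and y1 in [t0^++, t1], whence the double successors. These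
    spaces have dimension at most one, so a factorization known only to exist can be compared, up to
    a scalar, with a map chosen beforehand; no composition table is needed.

    The coaisle is never described by arcs. It is taken to be the right orthogonal, and the
    approximation property passes to direct sums, so only arcs have to be approximated. Conversely,
    an aisle is closed under extensions and summands, and the triangle of two crossing arcs turns
    this into the exchange of arcs. Exchange and suspension cannot see across a limit point; at that
    place the truncation triangle of an object outside the aisle has to be used. *)

Section LinearMaps.
Context {K : fieldType} {U V : lmodType K} (f : U -> V) (lin_f : linear f).

Lemma linear_add u v : f (u + v) = f u + f v.
Proof. by have := lin_f 1 u v; rewrite !scale1r. Qed.

Lemma linear_zero : f 0 = 0.
Proof. by apply: (addIr (f 0)); rewrite -linear_add !add0r. Qed.

Lemma linear_scale a u : f (a *: u) = a *: f u.
Proof. by have := lin_f a u 0; rewrite linear_zero !addr0. Qed.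

Lemma linear_opp u : f (- u) = - f u.
Proof. by rewrite -!scaleN1r linear_scale. Qed.

Lemma linear_big I (r : seq I) (F : I -> U) :
  f (\sum_(i <- r) F i) = \sum_(i <- r) f (F i).
Proof. by apply: (big_morph f linear_add linear_zero). Qed.

End LinearMaps.

Section Linear.
Context {K : fieldType} {C : linear_category K}.
Implicit Types X Y W S T : C.

Lemma compDl X Y W (g g' : Mor Y W) (f : Mor X Y) :
  (g + g') \oc f = g \oc f + g' \oc f.
Proof. exact: (linear_add (compose_linearl f)). Qed.

Lemma compDr X Y W (g : Mor Y W) (f f' : Mor X Y) :
  g \oc (f + f') = g \oc f + g \oc f'.
Proof. exact: (linear_add (compose_linearr g)). Qed.

Lemma comp0m X Y W (f : Mor X Y) : (0 : Mor Y W) \oc f = 0.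
Proof. exact: (linear_zero (compose_linearl f)). Qed.

Lemma compm0 X Y W (g : Mor Y W) : g \oc (0 : Mor X Y) = 0.
Proof. exact: (linear_zero (compose_linearr g)). Qed.

Lemma compNl X Y W (g : Mor Y W) (f : Mor X Y) : (- g) \oc f = - (g \oc f).
Proof. exact: (linear_opp (compose_linearl f)). Qed.

Lemma compNr X Y W (g : Mor Y W) (f : Mor X Y) : g \oc (- f) = - (g \oc f).
Proof. exact: (linear_opp (compose_linearr g)). Qed.

Lemma compZl X Y W a (g : Mor Y W) (f : Mor X Y) : (a *: g) \oc f = a *: (g \oc f).
Proof. exact: (linear_scale (compose_linearl f)). Qed.

Lemma compZr X Y W a (g : Mor Y W) (f : Mor X Y) : g \oc (a *: f) = a *: (g \oc f).
Proof. exact: (linear_scale (compose_linearr g)). Qed.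

Lemma comp_suml I (r : seq I) X Y W (F : I -> Mor Y W) (f : Mor X Y) :
  (\sum_(i <- r) F i) \oc f = \sum_(i <- r) F i \oc f.
Proof. exact: (linear_big (compose_linearl f)). Qed.

Lemma comp_sumr I (r : seq I) X Y W (g : Mor Y W) (F : I -> Mor X Y) :
  g \oc (\sum_(i <- r) F i) = \sum_(i <- r) g \oc F i.
Proof. exact: (linear_big (compose_linearr g)). Qed.

Lemma zero_target X Y (f : Mor X Y) : is_zero Y -> f = 0.
Proof. by move=> Y0; rewrite -(compose1m f) Y0 comp0m. Qed.

Lemma isomorphic_sym X Y : isomorphic X Y -> isomorphic Y X.
Proof. by case=> f [g [gf fg]]; exists g, f. Qed.

Lemma direct_sum_zero (X : 'I_0 -> C) S : is_zero S -> direct_sum X S.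
Proof.
move=> S0; exists (fun=> 0), (fun=> 0).
by split=> [[]|[]|] //; rewrite big_ord0.
Qed.

Lemma sub_zero U S : is_subcategory U -> is_zero S -> U S.
Proof.
move=> [sumU _] S0.
by apply: (sumU _ (fun=> S)); [exact: direct_sum_zero | case].
Qed.

Lemma sub_iso (U : set C) X Y : is_subcategory U -> isomorphic X Y -> U Y -> U X.
Proof.
move=> [sumU _] [f [g [gf fg]]] UY; apply: (sumU 1%N (fun=> Y)) => //.
exists (fun=> g), (fun=> f); split => [k|j k|] //; first by rewrite !ord1.
by rewrite big_ord1.
Qed.

Lemma direct_sumS m (X : 'I_m.+1 -> C) T S :
  direct_sum (fun k : 'I_m => X (lift ord0 k)) T -> direct_sum2 (X ord0) T S ->
  direct_sum X S.
Proof.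
move=> [i [p [pi pi0 ip]]] [i1 [i2 [p1 [p2 [e1 e2 e12 e21 es]]]]].
(* The type of a component depends on its index, so each case is transported along the equation that
   [unliftP] carries. *)
exists (fun k => match unliftP ord0 k with
   | UnliftSome j e => i2 \oc (eq_rect_r (fun k => Mor (X k) T) (i j) e)
   | UnliftNone e => eq_rect_r (fun k => Mor (X k) S) i1 e end).
exists (fun k => match unliftP ord0 k with
   | UnliftSome j e => (eq_rect_r (fun k => Mor T (X k)) (p j) e) \oc p2
   | UnliftNone e => eq_rect_r (fun k => Mor S (X k)) p1 e end).
split.
- move=> k; case: unliftP => [j|] e; subst k; rewrite /eq_rect_r /=.
    by rewrite -composeA (composeA p2) e2 compose1m pi.
  exact: e1.
- move=> j k; case: unliftP => [j'|] e; subst j; rewrite /eq_rect_r /=;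
    case: unliftP => [k'|] e; subst k; rewrite /eq_rect_r /= => ne.
  + rewrite -composeA (composeA p2) e2 compose1m pi0 // -(inj_eq (@lift_inj _ ord0)).
  + by rewrite -composeA e21 compm0.
  + by rewrite composeA e12 comp0m.
  + by [].
- rewrite big_ord_recl; case: unliftP => [j|] e.
    by have := congr1 val e; rewrite /= /bump.
  rewrite (eq_irrelevance e (erefl _)) {e} /eq_rect_r /= -es; congr (_ + _).
  rewrite -[X in X \oc p2]composem1 -ip comp_sumr comp_suml; apply: eq_bigr => j _.
  case: unliftP => [j'|] e; last first.
    by have := congr1 val e; rewrite /= /bump.
  have ej := lift_inj e; subst j'.
  by rewrite (eq_irrelevance e (erefl _)) /eq_rect_r /= !composeA.
Qed.

End Linear.

(** * Triangles and torsion pairs *)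

Section Additive.
Context {K : fieldType} {C : linear_category K}.
Implicit Types X Y S T : C.

Lemma is_subcategory_add_closure (G : set C) : is_subcategory (add_closure G).
Proof.
split=> [m X S sS GX U subU GU|X Y S sS GS U subU GU].
  by apply: (subU.1 _ _ _ sS) => k; apply: GX.
by apply: (subU.2 _ _ _ sS); apply: GS.
Qed.

Lemma sub_add_closure (G : set C) : G `<=` add_closure G.
Proof. by move=> X GX U _; apply. Qed.

Definition right_perp (U : set C) : set C :=
  [set Y | forall X, U X -> forall f : Mor X Y, f = 0].

Lemma is_subcategory_right_perp U : is_subcategory (right_perp U).
Proof.
split=> [m X S [i [p [_ _ ip]]] UX W UW f|X Y S [i [_ [p [_ [pi _ _ _ _]]]]] US W UW f].
  rewrite -(compose1m f) -ip comp_suml big1 // => k _.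
  by rewrite -composeA (UX k W UW (p k \oc f)) compm0.
by rewrite -(compose1m f) -pi -composeA (US W UW (i \oc f)) compm0.
Qed.

(** The objects without non-zero maps to a fixed [Y] form a subcategory, so orthogonality can be
    tested on generators. *)
Lemma right_perp_add_closure G : right_perp (add_closure G) = right_perp G.
Proof.
rewrite eqEsubset; split=> Y GY X.
  by move=> GX; apply: GY; exact: sub_add_closure.
move=> GX; apply: (GX [set W | forall f : Mor W Y, f = 0]) => //.
split=> [m V S [i [p [_ _ ip]]] VY f|V W S [i [_ [p [_ [pi _ _ _ _]]]]] SY f].
  rewrite -(composem1 f) -ip comp_sumr big1 // => k _.
  by rewrite composeA (VY k (f \oc i k)) comp0m.
by rewrite -(composem1 f) -pi composeA (SY (f \oc p)) comp0m.
Qed.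

(* A local endomorphism ring contains no idempotents besides 0 and 1. *)
Lemma local_indecomposable X : local_endomorphism_ring X -> indecomposable X.
Proof.
move=> [X0 locX]; split=> // A B [i1 [i2 [p1 [p2 [e1 e2 e12 e21 es]]]]].
have idem_inv (f : Mor X X) : is_iso f -> f \oc f = f -> f = idm X.
  by move=> [g [gf _]] ff; rewrite -gf -[X in _ = _ \oc X]ff composeA gf compose1m.
have [/idem_inv e|/idem_inv e] := locX (i1 \oc p1).
  right; have {}e : i1 \oc p1 = idm X by apply: e; rewrite composeA -(composeA i1) e1 composem1.
  by rewrite /is_zero -e2 -(composem1 p2) -e composeA e21 !comp0m.
left; have es' : idm X - i1 \oc p1 = i2 \oc p2 by rewrite -es addrC addKr.
have {}e : i2 \oc p2 = idm X.
  by rewrite -es' e // es' composeA -(composeA i2) e2 composem1.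
by rewrite /is_zero -e1 -(composem1 p1) -e composeA e12 !comp0m.
Qed.

Lemma direct_sum_summand m (X : 'I_m -> C) S k : direct_sum X S ->
  exists (i : Mor (X k) S) (p : Mor S (X k)), p \oc i = idm (X k).
Proof. by move=> [i [p [pi _ _]]]; exists (i k), (p k). Qed.

End Additive.

Section Triangles.
Context {K : fieldType} {C : triangle_data K} (TC : triangulated C).
Implicit Types (X Y W S T : C) (U V : set C).

Lemma suspD X Y (f g : Mor X Y) : suspm (f + g) = suspm f + suspm g.
Proof. exact: (linear_add (@suspm_linear _ _ TC X Y)). Qed.

Lemma susp0 X Y : suspm (0 : Mor X Y) = 0.
Proof. exact: (linear_zero (@suspm_linear _ _ TC X Y)). Qed.

Lemma suspZ X Y a (f : Mor X Y) : suspm (a *: f) = a *: suspm f.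
Proof. exact: (linear_scale (@suspm_linear _ _ TC X Y)). Qed.

Lemma susp_sum I (r : seq I) X Y (F : I -> Mor X Y) :
  suspm (\sum_(i <- r) F i) = \sum_(i <- r) suspm (F i).
Proof. exact: (linear_big (@suspm_linear _ _ TC X Y)). Qed.

Lemma susp_full X Y (h : Mor (susp X) (susp Y)) : exists f, suspm f = h.
Proof. by have [g _ gK] := @suspm_ff _ _ TC X Y; exists (g h); rewrite gK. Qed.

Lemma susp_faithful X Y : injective (fun f : Mor X Y => suspm f).
Proof. exact: bij_inj (@suspm_ff _ _ TC X Y). Qed.

Lemma susp_eq0 X Y (f : Mor X Y) : suspm f = 0 -> f = 0.
Proof. by rewrite -(@susp0 X Y) => /susp_faithful. Qed.

Lemma is_zero_susp X : is_zero X -> is_zero (susp X).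
Proof. by move=> X0; rewrite /is_zero -(suspm_id TC) X0 susp0. Qed.

Lemma direct_sum_susp m (X : 'I_m -> C) S :
  direct_sum X S -> direct_sum (fun k => susp (X k)) (susp S).
Proof.
move=> [i [p [pi pi0 ip]]]; exists (fun k => suspm (i k)), (fun k => suspm (p k)).
split=> [k|j k jk|].
- by rewrite -(suspm_comp TC) pi (suspm_id TC).
- by rewrite -(suspm_comp TC) pi0 // susp0.
- rewrite -(suspm_id TC) -ip susp_sum; apply: eq_bigr => k _.
  by rewrite (suspm_comp TC).
Qed.

Lemma direct_sum2_susp X Y S :
  direct_sum2 X Y S -> direct_sum2 (susp X) (susp Y) (susp S).
Proof.
move=> [i1 [i2 [p1 [p2 [e1 e2 e12 e21 es]]]]].
exists (suspm i1), (suspm i2), (suspm p1), (suspm p2).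
by split; rewrite -!(suspm_comp TC) -?suspD ?e1 ?e2 ?e12 ?e21 ?es ?susp0 ?(suspm_id TC).
Qed.

Lemma direct_sum_exists m (X : 'I_m -> C) : exists S, direct_sum X S.
Proof.
elim: m X => [|m IHm] X.
  by have [Q Q0] := has_zero TC; exists Q; exact: direct_sum_zero.
have [T sT] := IHm (fun k => X (lift ord0 k)).
by have [S sS] := has_sums TC (X ord0) T; exists S; exact: direct_sumS sT sS.
Qed.

(** TR3 maps the triangle on [idm X] to the given one, which makes [g \oc f] factor through a zero
    object. *)
Lemma dist_comp0 X Y W (f : Mor X Y) (g : Mor Y W) (h : Mor W (susp X)) :
  dist f g h -> g \oc f = 0.
Proof.
move=> fgh; have [Q Q0] := has_zero TC.
have [ |c [<- _]] := dist_fill TC (dist_id TC X Q0) fgh (a := idm X) (b := f).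
  by [].
by rewrite compm0.
Qed.

Lemma dist_comp0_susp X Y W (f : Mor X Y) (g : Mor Y W) (h : Mor W (susp X)) :
  dist f g h -> suspm f \oc h = 0.
Proof.
move/(dist_rot TC)/(dist_rot TC)/dist_comp0/eqP.
by rewrite compNl oppr_eq0 => /eqP.
Qed.

(** TR3 fills in the third map only, so both triangles are rotated first; the lift then appears
    suspended and is recovered because the suspension is full and faithful. *)
Lemma dist_lift X Y W (f : Mor X Y) (g : Mor Y W) (h : Mor W (susp X)) T
    (x : Mor T Y) : dist f g h -> g \oc x = 0 -> exists y, x = f \oc y.
Proof.
move=> /(dist_rot TC) fgh gx; have [Q Q0] := has_zero TC.
have [ |c [_ e]] := dist_fill TC (proj1 (dist_rot TC _ _ _) (dist_id TC T Q0)) fgh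
  (a := x) (b := 0).
  by rewrite comp0m gx.
have [y ey] := susp_full c; exists y; apply: susp_faithful.
move: e; rewrite compNl compNr (suspm_id TC) composem1 => /oppr_inj ->.
by rewrite (suspm_comp TC) ey.
Qed.

Lemma dist_lift_cone X Y W (f : Mor X Y) (g : Mor Y W) (h : Mor W (susp X)) T
    (x : Mor T W) : dist f g h -> h \oc x = 0 -> exists y, x = g \oc y.
Proof. by move/(dist_rot TC)/dist_lift; apply. Qed.

Lemma dist_lift_susp X Y W (f : Mor X Y) (g : Mor Y W) (h : Mor W (susp X)) T
    (x : Mor T (susp X)) : dist f g h -> suspm f \oc x = 0 -> exists y, x = h \oc y.
Proof.
by move/(dist_rot TC)/(dist_rot TC)/dist_lift => d fx; apply: d; rewrite compNl fx oppr0.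
Qed.

Lemma dist_extend X Y W (f : Mor X Y) (g : Mor Y W) (h : Mor W (susp X)) T
    (x : Mor Y T) : dist f g h -> x \oc f = 0 -> exists y, x = y \oc g.
Proof.
move=> fgh xf; have [Q Q0] := has_zero TC.
have d : dist (0 : Mor Q T) (idm T) (0 : Mor T (susp Q)).
  apply/(dist_rot TC); rewrite susp0 oppr0.
  exact: dist_id (is_zero_susp Q0).
have [ |y [e _]] := dist_fill TC fgh d (a := 0) (b := x).
  by rewrite xf compm0.
by exists y; rewrite e compose1m.
Qed.

(** With third map zero, [f] is monic and [g] has a section [s]; then [idm Y - s \oc g] is killed by
    [g] and factors through [f], which gives the retraction. *)
Lemma dist_split X Y W (f : Mor X Y) (g : Mor Y W) :
  dist f g 0 -> direct_sum2 X W Y.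
Proof.
move=> fg0.
have monof T (x : Mor T X) : f \oc x = 0 -> x = 0.
  move=> fx; apply: susp_eq0.
  have [ |y ->] := dist_lift_susp (x := suspm x) fg0; last by rewrite comp0m.
  by rewrite -(suspm_comp TC) fx susp0.
have [s gs] := dist_lift_cone (x := idm W) fg0 (comp0m _ _).
have [ |r fr] := dist_lift (x := idm Y - s \oc g) fg0.
  by rewrite compDr composem1 compNr composeA -gs compose1m subrr.
have gf := dist_comp0 fg0.
have rf : r \oc f = idm X.
  apply/eqP; rewrite -subr_eq0; apply/eqP/monof.
  by rewrite compDr compNr composeA -fr compDl compNl -composeA gf compm0 subr0
    compose1m composem1 subrr.
exists f, s, r, g; split=> //; last by rewrite -fr subrK.
by apply: monof; rewrite composeA -fr compDl compose1m compNl -composeA -gs composem1 subrr.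
Qed.

(** Closure under summands asks for a complement; the cone of the split monomorphism [s] is one,
    since its third map [l] equals [suspm r \oc (suspm s \oc l)], which is zero. *)
Lemma sub_retract U X T (s : Mor T X) (r : Mor X T) :
  is_subcategory U -> r \oc s = idm T -> U X -> U T.
Proof.
move=> [_ sumU] rs; have [W [k [l slk]]] := dist_cone TC s.
have l0 : l = 0.
  rewrite -(compose1m l) -(suspm_id TC) -rs (suspm_comp TC) -composeA.
  by rewrite (dist_comp0_susp slk) compm0.
by move: slk; rewrite l0 => /dist_split; exact: sumU.
Qed.

(** The map from [T] to its part in [V] vanishes, so the identity of [T] lifts and [T] is a retract
    of its part in [U]. *)
Lemma torsion_pair_left U V T : torsion_pair U V ->
  (forall Y, V Y -> forall f : Mor T Y, f = 0) -> U T.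
Proof.
move=> [subU subV _ tri] TV; have [X [Y [f [g [h [UX VY fgh]]]]]] := tri T.
have [ |s fs] := dist_lift (x := idm T) fgh; first by rewrite (TV _ VY g) comp0m.
by apply: (sub_retract subU (esym fs) UX).
Qed.

Lemma torsion_pair_right U V : torsion_pair U V -> V = right_perp U.
Proof.
move=> UV; have [subU subV hom0 tri] := UV.
rewrite eqEsubset; split=> [Y VY X UX f|T UT]; first exact: hom0 UX VY f.
have [X [Y [f [g [h [UX VY fgh]]]]]] := tri T.
have [ |r rg] := dist_extend (x := idm T) fgh; first by rewrite (UT _ UX f) compm0.
exact: (sub_retract subV (esym rg) VY).
Qed.

(** A map from [Y] to an object of [V] vanishes on [X], hence factors through [W], where it is
    zero. *)
Lemma torsion_pair_extension U V X Y W
    (f : Mor X Y) (g : Mor Y W) (h : Mor W (susp X)) :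
  torsion_pair U V -> dist f g h -> U X -> U W -> U Y.
Proof.
move=> UV fgh UX UW; have [_ _ hom0 _] := UV.
apply: (torsion_pair_left UV) => T VT x.
have [ |y ->] := dist_extend (x := x) fgh; first exact: hom0 UX VT _.
by rewrite (hom0 _ _ UW VT y) comp0m.
Qed.

(* The second condition makes the cone of [f] right orthogonal to [G], so no
   minimality of the approximation is needed. *)
Definition approximable (G : set C) T :=
  exists (X : C) (f : Mor X T), add_closure G X /\
  forall Y, G Y -> (forall g : Mor Y T, exists g', g = f \oc g') /\
    (forall h : Mor Y (susp X), suspm f \oc h = 0 -> h = 0).

Lemma approximable_direct_sum G m (T : 'I_m -> C) S :
  direct_sum T S -> (forall k, approximable G (T k)) -> approximable G S.
Proof.
move=> [iT [pT [pi pi0 ip]]] appT.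
(* The type of the k-th map depends on the chosen [X k], so the objects are chosen first and the
   maps are extracted with [cid]. *)
have [X {}appT] := choice appT; have {appT}[f appT] : exists f : forall k, Mor (X k) (T k),
  forall k, add_closure G (X k) /\ forall Y, G Y ->
   (forall g : Mor Y (T k), exists g', g = f k \oc g') /\
   (forall h : Mor Y (susp (X k)), suspm (f k) \oc h = 0 -> h = 0).
  exists (fun k => projT1 (cid (appT k))) => k.
  exact: (projT2 (cid (appT k))).
have [SX sumX] := direct_sum_exists X; have [iX [pX [piX pi0X ipX]]] := sumX.
exists SX, (\sum_k iT k \oc f k \oc pX k); split=> [ |Y GY].
  by apply: (is_subcategory_add_closure G).1 sumX _ => k; case: (appT k).
have pf k : pT k \oc (\sum_k iT k \oc f k \oc pX k) = f k \oc pX k.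
  rewrite comp_sumr (bigD1 k) //= !composeA pi compose1m big1 ?addr0 // => j jk.
  by rewrite !composeA pi0 1?eq_sym // !comp0m.
split=> [g|h h0].
  have [g' eg] : exists g' : forall k, Mor Y (X k), forall k, pT k \oc g = f k \oc g' k.
    exists (fun k => projT1 (cid (((appT k).2 Y GY).1 (pT k \oc g)))) => k.
    exact: (projT2 (cid (((appT k).2 Y GY).1 (pT k \oc g)))).
  exists (\sum_k iX k \oc g' k).
  rewrite -[LHS]compose1m -ip !comp_suml; apply: eq_bigr => k _.
  rewrite -!composeA; congr (_ \oc _); rewrite eg; congr (_ \oc _).
  rewrite comp_sumr (bigD1 k) //= !composeA piX compose1m big1 ?addr0 // => j jk.
  by rewrite !composeA pi0X 1?eq_sym // !comp0m.
rewrite -(compose1m h) -(suspm_id TC) -ipX susp_sum comp_suml big1 // => k _.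
rewrite (suspm_comp TC) -composeA.
rewrite (((appT k).2 Y GY).2 (suspm (pX k) \oc h)) ?compm0 //.
by rewrite composeA -(suspm_comp TC) -pf (suspm_comp TC) -composeA h0 compm0.
Qed.

Lemma approximable_iso G T T' : isomorphic T T' -> approximable G T -> approximable G T'.
Proof.
move=> [u [v [vu uv]]] [X [f [GX app]]]; exists X, (u \oc f); split=> // Y GY.
have [lift inj] := app Y GY; split=> [g|h h0].
  have [g' eg] := lift (v \oc g); exists g'.
  by rewrite -composeA -eg composeA uv compose1m.
apply: inj; rewrite -[LHS]compose1m -(suspm_id TC) -vu (suspm_comp TC).
by rewrite composeA -[in LHS](composeA (suspm v)) -(suspm_comp TC) -composeA h0 compm0.
Qed.

(** A map from [G] to the cone of an approximation has zero composite with the connecting map, hence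
    comes from [T], hence from [X], and there it dies. *)
Lemma t_structure_add_closure (G : set C) :
  (forall T, approximable G T) -> (forall X, G X -> add_closure G (susp X)) ->
  t_structure (add_closure G) (right_perp (add_closure G)).
Proof.
move=> app suspG; split; first split.
- exact: is_subcategory_add_closure.
- exact: is_subcategory_right_perp.
- by move=> X Y GX GY f; exact: GY.
- move=> T; have [X [f [GX appX]]] := app T.
  have [W [g [h fgh]]] := dist_cone TC f.
  exists X, W, f, g, h; split=> //; rewrite right_perp_add_closure => Y GY x.
  have [lift inj] := appX Y GY.
  have [ |y ->] := dist_lift_cone (x := x) fgh.
    by apply: inj; rewrite composeA (dist_comp0_susp fgh) comp0m.
  have [z ->] := lift y.
  by rewrite composeA (dist_comp0 fgh) comp0m.
(* The objects whose suspension lies in the closure form a subcategory containing [G]. *)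
- move=> X GX; apply: (GX [set W | add_closure G (susp W)]) => //.
  have [sum2 summand] := is_subcategory_add_closure G.
  split=> [m Y S /direct_sum_susp sS GY|Y W S /direct_sum2_susp sS GS].
    exact: sum2 sS GY.
  exact: summand sS GS.
Qed.

End Triangles.

(** * Cyclic order on n copies of the integers *)

Lemma int_max (S : int -> Prop) k0 b : S k0 -> (forall k, S k -> k <= b) ->
  exists m, S m /\ forall k, S k -> k <= m.
Proof.
move=> Sk0; have [N] := ubnP `|b - k0|%N; elim: N b => // N IHN b leN Sb.
have [SbT|SbF] := pselect (S b); first by exists b.
have k0b := Sb _ Sk0; have k0neb : k0 <> b by move=> e; rewrite e in Sk0.
apply: (IHN (b - 1)) => [|k Sk]; first by lia.
have kneb : k <> b by move=> e; rewrite e in Sk.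
by have := Sb _ Sk; lia.
Qed.

Section Points.
Context {n : nat}.
Notation pt := ('I_n * int)%type.
Implicit Types (p q r s t u : pt).

(* The pair (i, k) stands for the k-th point of Z between [a_i] and [a_(i+1)],
   counted from an arbitrary origin. *)
Definition ltp p q := (p.1 < q.1)%N || (p.1 == q.1 :> nat) && (p.2 < q.2).
Definition shp (k : int) p : pt := (p.1, p.2 + k).
Definition ccyc p q r :=
  [|| ltp p q && ltp q r, ltp q r && ltp r p | ltp r p && ltp p q].
(** These two triples imply the other two of [cyc4], by rotation. *)
Definition ccyc4 p q r s := ccyc p q r && ccyc r s p.
Definition ccross p q r s := ccyc4 p r q s || ccyc4 p s q r.
Definition carc p q := ~~ [|| q == p, q == shp 1 p | q == shp (-1) p].
(** The point tested is the middle argument: it lies in the closed anti-clockwise interval from [p]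
    to [q], which is one point for [p = q], as for [ivcc]. *)
Definition cin p r q := [|| ccyc p r q, r == p | r == q].

Lemma eqpE p q : (p == q) = (p.1 == q.1 :> nat) && (p.2 == q.2).
Proof. by rewrite -pair_eqE. Qed.

Lemma shp0 p : shp 0 p = p.
Proof. by case: p => i k; rewrite /shp /= addr0. Qed.

Lemma shpD k l p : shp k (shp l p) = shp (l + k) p.
Proof. by rewrite /shp /= addrA. Qed.

(* Spreading the n lines far apart in the integers makes linear arithmetic decide
   the cyclic order of a finite configuration. *)
Lemma embed (ps : seq pt) : exists f : pt -> int,
  [/\ {in ps &, forall p q, ltp p q = (f p < f q)},
      {in ps &, forall p q, (p == q) = (f p == f q)}
    & forall k p, f (shp k p) = f p + k].
Proof.
pose M : int := (\sum_(p <- ps) `|p.2|%N)%:Z + 1.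
have leM p : p \in ps -> - M < p.2 < M.
  move=> pps; have : (`|p.2|%N <= \sum_(q <- ps) `|q.2|%N)%N.
    by rewrite (perm_big _ (perm_to_rem pps)) big_cons leq_addr.
  by rewrite /M; lia.
(* All second coordinates lie strictly between [- M] and [M], so lines placed at distance [M + M] do
   not overlap. *)
clearbody M; exists (fun p => (p.1 : nat)%:Z * (M + M) + p.2).
have aux (i j : nat) (k l : int) : - M < k < M -> - M < l < M -> (i < j)%N ->
  i%:Z * (M + M) + k < j%:Z * (M + M) + l.
  move=> kM lM ij; have : 0 <= (j%:Z - i%:Z - 1) * M by rewrite mulr_ge0; lia.
  rewrite !mulrDl !mulrDr !mulNr mul1r; set x := _ * M; set y := _ * M.
  lia.
split=> [p q pps qps|p q pps qps|k p]; last by rewrite /shp /= addrA.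
  rewrite /ltp; have [lt|lt|e] := ltngtP p.1 q.1; rewrite /=.
  - by rewrite aux ?leM.
  - by apply/esym/negbTE; rewrite -leNgt ltW // aux ?leM.
  - by rewrite e ltrD2l.
rewrite eqpE; have [lt|lt|e] := ltngtP p.1 q.1; rewrite /=.
- by apply/esym/negbTE; rewrite lt_eqF // aux ?leM.
- by apply/esym/negbTE; rewrite gt_eqF // aux ?leM.
- by rewrite e (inj_eq (addrI _)).
Qed.

End Points.

(** The list must contain every point that the goal compares, shifted ones included; shifts become
    additions, and the images are generalized to integers fit for [lia]. *)
Ltac embed_in ps :=
  let f := fresh "f" in let fl := fresh "fl" in let fe := fresh "fe" in
  let fs := fresh "fs" in
  have [f [fl fe fs]] := embed ps;
  rewrite /ccross /cin /carc /ccyc4 /ccyc;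
  rewrite ?fl ?fe ?inE ?eqxx ?orbT // ?fs; clear fl fe fs;
  repeat match goal with |- context[f ?p] => generalize (f p) => ? end;
  clear f.

Section Order.
Context {n : nat}.
Notation pt := ('I_n * int)%type.
Implicit Types (p q r s t u y : pt).

Lemma carc_sym p q : carc p q = carc q p.
Proof.
by embed_in [:: p; q; shp 1 p; shp (-1) p; shp 1 q; shp (-1) q]; lia.
Qed.

Lemma ccross_sym p q r s : ccross p q r s -> ccross r s p q.
Proof.
case/orP=> /andP[]; [move=> a b; apply/orP; right|move=> a b; apply/orP; left];
apply/andP; split; move: a b; embed_in [:: p; q; r; s]; lia.
Qed.

(** Exchanging an arc with its suspension is what moves a single endpoint in [ptolemy_lower]. *)
Lemma ccross_shift p q : carc p q -> ccross p q (shp (-1) p) (shp (-1) q).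
Proof.
rewrite carc_sym => pq; apply/orP; right; apply/andP; split; move: pq;
embed_in [:: p; q; shp 1 p; shp (-1) p; shp 1 q; shp (-1) q]; lia.
Qed.

(** Crossing is cyclic whereas [non_crossing] is stated for linearly ordered indices; the four cases
    say where the cut falls. *)
Lemma ccyc4_chain p q r s : ccyc4 p q r s ->
  [\/ [/\ ltp p q, ltp q r & ltp r s], [/\ ltp q r, ltp r s & ltp s p],
      [/\ ltp r s, ltp s p & ltp p q] | [/\ ltp s p, ltp p q & ltp q r]].
Proof.
move=> pqrs; have : [|| [&& ltp p q, ltp q r & ltp r s],
  [&& ltp q r, ltp r s & ltp s p], [&& ltp r s, ltp s p & ltp p q]
  | [&& ltp s p, ltp p q & ltp q r]].
  by move: pqrs; embed_in [:: p; q; r; s]; lia.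
by case/or4P=> /and3P; [exact: Or41|exact: Or42|exact: Or43|exact: Or44].
Qed.

Lemma ccyc4_rot p q r s : ccyc4 p q r s -> ccyc4 q r s p.
Proof.
by case/andP=> a b; apply/andP; split; move: a b; embed_in [:: p; q; r; s]; lia.
Qed.

Lemma cin_trans_right u s y t : cin u y s -> cin u s t -> cin y s t.
Proof. by embed_in [:: u; s; y; t]; lia. Qed.

Lemma carc_shift k p q : carc (shp k p) (shp k q) = carc p q.
Proof.
rewrite /carc !eqpE /shp /=; congr (~~ [|| _ && _, _ && _ | _ && _]);
by apply/eqP/eqP; lia.
Qed.

(** * Position of arcs relative to a fixed arc [{t0, t1}] *)

Section Approximation.
Context (t0 t1 : pt).
Hypothesis t01 : carc t0 t1.

(** The points strictly between [t1^+] and [t0^+] are those of [t1^++, t0]. So the two windows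
    describe, in one labelling, the arcs with a non-zero map to [{t0, t1}]; [hom_cin] is the
    converse. *)
Lemma cin_hom y0 y1 : cin (shp 2 t1) y0 t0 -> cin (shp 2 t0) y1 t1 ->
  ccyc4 y0 (shp 1 t0) y1 (shp 1 t1).
Proof.
move=> a b; apply/andP; split; move: t01 a b; rewrite /carc;
embed_in [:: t0; t1; y0; y1; shp 1 t0; shp (-1) t0; shp 2 t0; shp 1 t1; shp 2 t1]; lia.
Qed.

(** The two windows are separated by [t0^+] and [t1^+], so their points are never equal or
    adjacent. *)
Lemma cin_carc y0 y1 : cin (shp 2 t1) y0 t0 -> cin (shp 2 t0) y1 t1 -> carc y0 y1.
Proof.
move: t01; rewrite /carc.
embed_in [:: t0; t1; y0; y1; shp 1 t0; shp (-1) t0; shp 2 t0; shp 1 t1; shp 2 t1;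
  shp 1 y0; shp (-1) y0]; lia.
Qed.

Lemma hom_cin y0 y1 : ccyc4 y0 (shp 1 t0) y1 (shp 1 t1) ->
  cin (shp 2 t1) y0 t0 && cin (shp 2 t0) y1 t1.
Proof.
move=> a; apply/andP; split; move: t01 a; rewrite /carc;
embed_in [:: t0; t1; y0; y1; shp 1 t0; shp (-1) t0; shp 2 t0; shp 1 t1; shp 2 t1]; lia.
Qed.

Context (s0 s1 y0 y1 : pt).
Hypotheses (s0in : cin (shp 2 t1) s0 t0) (s1in : cin (shp 2 t0) s1 t1)
  (max0 : cin (shp 2 t1) y1 t0 -> cin (shp 2 t1) y1 s0)
  (max1 : cin (shp 2 t0) y0 t1 -> cin (shp 2 t0) y0 s1)
  (ys : ccyc4 y0 s0 y1 s1).

(** By maximality of [s0], membership in the first window would put [y1] in [t1^++, s0], which is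
    disjoint from the gap between [s0] and [s1]. *)
Let y1out : ~~ cin (shp 2 t1) y1 t0.
Proof.
apply/negP => /max0; case/andP: ys; move: t01 s0in s1in; rewrite /carc.
embed_in [:: t0; t1; y0; y1; s0; s1; shp 1 t0; shp (-1) t0; shp 2 t0; shp 1 t1; shp 2 t1].
lia.
Qed.

Let y0out : ~~ cin (shp 2 t0) y0 t1.
Proof.
apply/negP => /max1; case/andP: ys; move: t01 s0in s1in; rewrite /carc.
embed_in [:: t0; t1; y0; y1; s0; s1; shp 1 t0; shp (-1) t0; shp 2 t0; shp 1 t1; shp 2 t1].
lia.
Qed.

Let y1mid : ccyc t0 y1 s1.
Proof.
have : ccyc s0 y1 s1 by case/andP: (ccyc4_rot ys).
move: t01 y1out s0in s1in; rewrite /carc.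
embed_in [:: t0; t1; y0; y1; s0; s1; shp 1 t0; shp (-1) t0; shp 2 t0; shp 1 t1; shp 2 t1].
lia.
Qed.

Let y0mid : ccyc t1 y0 s0.
Proof.
have : ccyc s1 y0 s0 by case/andP: (ccyc4_rot (ccyc4_rot (ccyc4_rot ys))).
move: t01 y0out s0in s1in; rewrite /carc.
embed_in [:: t0; t1; y0; y1; s0; s1; shp 1 t0; shp (-1) t0; shp 2 t0; shp 1 t1; shp 2 t1].
lia.
Qed.

(** Moving [s0] to [t0] and [s1] to [t1] passes neither [y0] nor [y1], so the crossing persists. *)
Lemma cross_propagate : ccyc4 y0 t0 y1 t1.
Proof.
apply/andP; split; move: t01 s0in s1in y0mid y1mid; rewrite /carc;
embed_in [:: t0; t1; y0; y1; s0; s1; shp 1 t0; shp (-1) t0; shp 2 t0; shp 1 t1; shp 2 t1];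
lia.
Qed.

(** With [cross_between1] this puts the suspension of [{s0, s1}] between [{y0, y1}] and the
    suspension of [{t0, t1}], as a factorization requires. *)
Lemma cross_between0 : cin y0 (shp (-1) s0) (shp (-1) t0).
Proof.
move: t01 s0in s1in y0mid y1mid; rewrite /carc.
embed_in [:: t0; t1; y0; y1; s0; s1; shp 1 t0; shp (-1) t0; shp 2 t0; shp 1 t1; shp 2 t1;
   shp (-1) s0].
lia.
Qed.

Lemma cross_between1 : cin y1 (shp (-1) s1) (shp (-1) t1).
Proof.
move: t01 s0in s1in y0mid y1mid; rewrite /carc.
embed_in [:: t0; t1; y0; y1; s0; s1; shp 1 t0; shp (-1) t0; shp 2 t0; shp 1 t1; shp 2 t1;
   shp (-1) s1; shp (-1) t1].
lia.
Qed.

End Approximation.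
(** The position required by the factorization axiom, for endomorphisms of one arc; by [cin_self]
    the intermediate arc is then forced. *)
Lemma ccyc4_self p q : carc p q -> ccyc4 p (shp 1 p) q (shp 1 q).
Proof. by move=> pq; apply: (cin_hom pq); rewrite /cin eqxx !orbT. Qed.

Lemma cin_self p u : cin p u p -> u = p.
Proof.
rewrite /cin orbb => /orP[|/eqP//]; rewrite /ccyc /ltp.
by case: ltngtP => //=; lia.
Qed.

End Order.

(** * Decorated non-crossing partitions in coordinates *)

(* The possible values of [x_i] in the i-th segment: [a_i], its element number k,
   and [a_(i+1)]. *)
Inductive level := Low | Mid of int | High.

Definition below (l : level) (k : int) : bool :=
  match l with Low => false | Mid m => k <= m | High => true end.

Lemma below_le l k k' : k' <= k -> below l k -> below l k'.
Proof. by case: l => //= m; exact: le_trans. Qed.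

Lemma below_unbounded l b : l <> Low -> exists2 k, k <= b & below l k.
Proof.
case: l => //= [m|] _; last by exists b.
by exists (Num.min b m); rewrite ge_min lexx ?orbT.
Qed.

Lemma level_ext l l' : below l =1 below l' -> l = l'.
Proof.
case: l l' => [|m|] [|m'|] //= e; do ?[by have := e 0].
- by have := e m'; rewrite /= lexx.
- by have := e m; rewrite /= lexx.
- congr Mid; apply: le_anti.
  by have := e m; have := e m'; rewrite /= !lexx => -> <-.
- by have := e (m + 1); rewrite /= gerDl.
- by have := e (m' + 1); rewrite /= gerDl.
Qed.

Lemma level_of (D : int -> Prop) : (forall k l, l <= k -> D k -> D l) ->
  exists l, forall k, D k <-> below l k.
Proof.
move=> Dle; have [[k0 Dk0]|D0] := pselect (exists k, D k); last first.
  by exists Low => k; split=> // Dk; case: D0; exists k.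
have [all|] := pselect (forall k, D k); first by exists High.
move=> /existsNP[b Db]; have [|m [Dm mmax]] := @int_max D k0 b Dk0.
  by move=> k Dk; rewrite leNgt; apply/negP => bk; apply: Db; apply: Dle Dk; exact: ltW.
by exists (Mid m) => k; split=> [/mmax|/Dle]; last exact.
Qed.

Section Regions.
Context {n : nat} (P : {set {set 'I_n}}) (L : 'I_n -> level).
Notation pt := ('I_n * int)%type.
Implicit Types (p q r s t u y : pt) (B : {set 'I_n}).

(** The ranges of a decoration in terms of levels; the alternative [n = 1] stands for the formal
    right endpoint. *)
Definition levels_ok := forall i, (L i = Low -> singleton P i) /\
  (L i = High -> n = 1%N \/ adjacency P i).

Definition region B p := (p.1 \in B) && below (L p.1) p.2.

Definition xarc p q := carc p q /\ exists2 B, B \in P & region B p && region B q.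

Hypothesis ncP : non_crossing P.
Hypothesis okL : levels_ok.

Lemma block_eq B B' i : B \in P -> B' \in P -> i \in B -> i \in B' -> B = B'.
Proof.
have [/and3P[_ trivP _] _] := ncP.
by move=> PB PB' iB iB'; rewrite -(def_pblock trivP PB iB) (def_pblock trivP PB' iB').
Qed.

Lemma singleton_block B i j : B \in P -> singleton P i -> i \in B -> j \in B -> i = j.
Proof.
move=> PB Pi iB jB; apply/eqP; rewrite eq_sym -finset.in_set1.
by rewrite (block_eq Pi PB (finset.set11 i) iB).
Qed.

Lemma nonlow_block B i j : B \in P -> i \in B -> j \in B -> i <> j -> L i <> Low.
Proof. by move=> PB iB jB ij /(okL i).1 Pi; apply: ij; exact: singleton_block Pi iB jB. Qed.

Lemma ordS_neq (i : 'I_n) : n <> 1%N -> ordS i <> i.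
Proof.
move=> n1 /(congr1 val) /=; have := ltn_ord i.
rewrite leq_eqVlt => /orP[/eqP e|lt]; last by rewrite modn_small //; lia.
by rewrite e modnn => e'; rewrite -e' in e; lia.
Qed.

Lemma ordS_cases (i : 'I_n) :
  ordS i = i.+1 :> nat \/ ordS i = 0%N :> nat /\ i.+1 = n.
Proof.
have := ltn_ord i; rewrite leq_eqVlt => /orP[/eqP e|lt]; [right|left].
  by rewrite /= e modnn.
by rewrite /= modn_small.
Qed.

Lemma cin_next (i : 'I_n) (k l : int) v : n <> 1%N ->
  cin (i, k) v (ordS i, l) -> v.1 = ordS i \/ v.1 = i /\ k <= v.2.
Proof.
move=> n1; rewrite /cin => /or3P[c|/eqP ->|/eqP ->]; [|by right|by left].
have := ordS_cases i; have := @ordS_neq i n1; move: c; move: (ordS i) => i'.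
case: v => j m /= c i'i i'E.
have [->|ji'] := eqVneq j i'; [by left|right].
have {}ji' : j <> i' :> nat by move/val_inj/eqP; rewrite (negbTE ji').
have {}i'i : i' <> i :> nat by move/val_inj.
have jn := ltn_ord j.
suff /andP[/eqP/val_inj ji km] : (j == i :> nat) && (k <= m) by [].
by move: c; rewrite /ccyc /ltp /=; case: i'E => [i'E|[i'E ei]]; lia.
Qed.

Lemma cin_before_next (i : 'I_n) (k k' l : int) : n <> 1%N -> k < k' ->
  cin (i, k) (i, k') (ordS i, l).
Proof.
move=> n1 kk; have := ordS_cases i; have := @ordS_neq i n1; move: (ordS i) => i' i'i i'E.
have {}i'i : i' <> i :> nat by move/val_inj.
apply/orP; left; rewrite /ccyc /ltp /=.
by case: i'E => [i'E|[i'E ei]]; lia.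
Qed.

(* This is where the range of the decoration at an adjacency makes the maxima of
   regions exist. *)
Lemma high_next B i b : B \in P -> i \in B -> L i = High ->
  ordS i \in B /\ exists2 k, k <= b & below (L (ordS i)) k.
Proof.
move=> PB iB Li; have [n1|n1] := eqVneq n 1%N.
  have e : ordS i = i.
    by apply: val_inj => /=; have := ltn_ord i; have := ltn_ord (ordS i); lia.
  by rewrite e Li; split=> //; exists b.
have [e|adj] := (okL i).2 Li; first by rewrite e in n1.
move/existsP: adj => [B' /and3P[PB' iB' siB']].
rewrite -(block_eq PB PB' iB iB') in siB'; split=> //.
by apply/below_unbounded/(nonlow_block PB siB' iB)/ordS_neq/eqP.
Qed.

Lemma region_shp B p k : 0 <= k -> region B p -> region B (shp (- k) p).
Proof.
by move=> k0 /andP[pB pL]; rewrite /region /= pB (below_le _ pL) // gerBl.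
Qed.

(** On the last line that [S] meets, the second alternative is impossible, so [S] is bounded there
    and has a greatest element. *)
Lemma lex_max (S : pt -> Prop) p0 : S p0 ->
  (forall i k, S (i, k) -> (exists b, forall l, S (i, l) -> l <= b) \/
     exists (j : 'I_n) l, (i < j)%N /\ S (j, l)) ->
  exists m, S m /\ forall p, S p -> ~~ ltp m p.
Proof.
move=> Sp0 bdS; pose occ (i : 'I_n) := `[< exists k, S (i, k) >].
have occ0 : occ p0.1 by apply/asboolP; exists p0.2; case: p0 Sp0.
have [i /asboolP[k Sik] imax] := arg_maxnP val occ0.
have [[b bS]|[j [l [ij Sjl]]]] := bdS i k Sik; last first.
  by have /= := imax j (asboolT (ex_intro _ l Sjl)); rewrite leqNgt ij.
have [m [Sm mmax]] := int_max Sik bS; exists (i, m); split=> // -[j l] Sjl.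
have ji : (j <= i)%N by apply: imax; apply/asboolP; exists l.
rewrite /ltp /= negb_or -leqNgt ji /= negb_and.
by have [/val_inj e|//] := eqP; rewrite -e in Sjl; rewrite -leNgt mmax.
Qed.

Lemma region_max B u t : B \in P -> (exists p, region B p && cin u p t) ->
  exists s, [/\ region B s, cin u s t &
    forall p, region B p -> cin u p t -> cin u p s].
Proof.
move=> PB [p0 /andP[p0B p0ut]].
(* [S1] is the final part of the interval: all of it when [u] does not come after [t] in the linear
   order, and otherwise the part behind the cut. If it is non-empty, its last point is the
   maximum. *)
pose S1 p := [&& region B p, ~~ ltp t p & ltp t u || ~~ ltp p u].
have [[p S1p]|noS1] := pselect (exists p, S1 p).
  have [|s [/and3P[sB st su] smax]] := @lex_max S1 p S1p.
    move=> i k /and3P[/andP[/= iB ikL] ikt iku].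
    have [it|ti|it] := ltngtP i t.1.
    - move: ikL; case Li: (L i) => [|m|] // _.
        by left; exists m => l /and3P[/andP[_]]; rewrite /= Li.
      have [siB [l lm lL]] := high_next (Num.min k t.2) PB iB Li.
      have si : ordS i = i.+1 :> nat.
        by rewrite /= modn_small //; exact: leq_ltn_trans it (ltn_ord _).
      right; exists (ordS i), l; split; first by rewrite si.
      rewrite /S1 /region /= siB lL /=; move: ikt iku lm; rewrite /ltp si /= le_min.
      by lia.
    - by move: ikt; rewrite /ltp /= ti.
    - left; exists t.2 => l /and3P[_ + _]; rewrite /ltp /= it ltnn eqxx /=.
      by rewrite -leNgt.
  exists s; split=> // [|p' p'B].
    by move: st su; embed_in [:: s; t; u]; lia.
  have := smax p'; rewrite /S1 p'B /=; move: st su.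
  by embed_in [:: s; t; u; p']; lia.
(* What remains is an interval running through the cut whose points of the region all lie before the
   cut. *)
have tu : ltp t u.
  apply/negP => /negP tu; apply: noS1; exists p0; rewrite /S1 p0B /=.
  by move: p0ut tu; embed_in [:: t; u; p0]; lia.
pose S2 p := region B p && ~~ ltp p u.
have S2p0 : S2 p0.
  rewrite /S2 p0B /=; apply/negP => p0u; apply: noS1; exists p0; rewrite /S1 p0B tu.
  by move: p0ut p0u tu; embed_in [:: t; u; p0]; lia.
have [|s [/andP[sB su] smax]] := @lex_max S2 p0 S2p0.
  move=> i k /andP[/andP[/= iB ikL] iku].
  move: ikL; case Li: (L i) => [|m|] // _.
    by left; exists m => l /andP[/andP[_]]; rewrite /= Li.
  have [siB [l lm lL]] := high_next (Num.min k t.2) PB iB Li.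
  right; exists (ordS i), l.
  have [lt|ge] := ltnP i.+1 n.
    have si : ordS i = i.+1 :> nat by rewrite /= modn_small.
    split; first by rewrite si.
    rewrite /S2 /region /= siB lL /=; move: iku lm; rewrite /ltp si /= le_min.
    by lia.
  have si : ordS i = 0%N :> nat.
    have e : i.+1 = n by have := ltn_ord i; lia.
    by rewrite /= e modnn.
  (* A [High] level on the last line continues on the first line, behind the cut, where [S1] was
     assumed empty. *)
  case: noS1; exists (ordS i, l); rewrite /S1 /region /= siB lL tu /=.
  by move: lm; rewrite /ltp si /= le_min; lia.
exists s; split=> // [|p' p'B].
  by move: tu su; embed_in [:: s; t; u]; lia.
have := smax p'; rewrite /S2 p'B /=; have : ~~ S1 p' by apply/negP=> ?; apply: noS1; exists p'.
rewrite /S1 p'B tu /=; move: su tu.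
by embed_in [:: s; t; u; p']; lia.
Qed.

Lemma region_ltp B B' p q : B \in P -> B' \in P -> B != B' ->
  region B p -> region B' q -> ltp p q -> (p.1 < q.1)%N.
Proof.
move=> PB PB' BB' /andP[pB _] /andP[qB' _] /orP[//|/andP[/eqP/val_inj e _]].
by move: BB'; rewrite (block_eq PB PB' pB) ?eqxx // e.
Qed.

(** Between points of different blocks the linear order is a strict order of line numbers, so each
    way of cutting a crossing contradicts [non_crossing]. *)
Lemma region_noncrossing B B' p q r s : B \in P -> B' \in P -> B != B' ->
  region B p -> region B q -> region B' r -> region B' s -> ~~ ccross p q r s.
Proof.
have [_ nc] := ncP.
have aux D D' p' q' r' s' : D \in P -> D' \in P -> D != D' ->
    region D p' -> region D q' -> region D' r' -> region D' s' ->
    ltp p' r' -> ltp r' q' -> ltp q' s' -> False.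
  move=> PD PD' DD' pD qD rD sD' pr rq qs.
  have D'D : D' != D by rewrite eq_sym.
  move/negP: (DD'); apply; apply/eqP.
  by apply: (nc _ _ p'.1 r'.1 q'.1 s'.1 PD PD');
    [exact: (region_ltp PD PD' DD' pD rD pr)
    |exact: (region_ltp PD' PD D'D rD qD rq)|exact: (region_ltp PD PD' DD' qD sD' qs)
    |case/andP: pD|case/andP: qD|case/andP: rD|case/andP: sD'].
have aux4 p' q' r' s' : region B p' -> region B q' -> region B' r' -> region B' s' ->
    B \in P -> B' \in P -> B != B' -> ccyc4 p' r' q' s' -> False.
  move=> pB qB rB sB PB PB' BB'; have B'B : B' != B by rewrite eq_sym.
  case/ccyc4_chain=> -[a b c]; first exact: aux pB qB rB sB a b c.
  - exact: aux PB' PB B'B rB sB qB pB a b c.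
  - exact: aux PB PB' BB' qB pB sB rB a b c.
  - exact: aux PB' PB B'B sB rB pB qB a b c.
move=> PB PB' BB' pB qB rB sB; apply/negP => /orP[].
  exact: aux4 pB qB rB sB PB PB' BB'.
exact: aux4 pB qB sB rB PB PB' BB'.
Qed.

(** A shortest arc inside the segment with upper end [(i, k)], whence the 2; such arcs detect the
    level. *)
Lemma xarc_line i k : below (L i) k -> xarc (i, k) (i, k - 2).
Proof.
have [/and3P[/eqP covP _ _] _] := ncP.
move=> ikL; split.
  by rewrite /carc !eqpE /=; lia.
have : i \in finset.cover P by rewrite covP inE.
case/finset.bigcupP=> B PB iB; exists B => //.
by rewrite /region /= iB ikL (below_le _ ikL) // gerBl.
Qed.

Lemma xarc_below p q : xarc p q -> below (L p.1) p.2.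
Proof. by move=> [_ [B _ /andP[/andP[]]]]. Qed.

Lemma xarc_pblock i j : i <> j ->
  j \in finset.pblock P i <-> exists k l, xarc (i, k) (j, l).
Proof.
have [/and3P[/eqP covP trivP _] _] := ncP.
move=> ij; split=> [jPi|[k [l [_ [B PB /andP[/andP[iB _] /andP[jB _]]]]]]].
  have iP : i \in finset.pblock P i by rewrite finset.mem_pblock covP inE.
  have PB : finset.pblock P i \in P by apply: finset.pblock_mem; rewrite covP inE.
  have [k _ kL] := below_unbounded 0 (nonlow_block PB iP jPi ij).
  have [l _ lL] := below_unbounded 0 (nonlow_block PB jPi iP (nesym ij)).
  exists k, l; split; last by exists (finset.pblock P i) => //; rewrite /region /= iP jPi kL.
  rewrite /carc !eqpE /=.
  by have /negbTE -> : j != i :> nat by apply/eqP => /val_inj /esym.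
by rewrite (def_pblock trivP PB iB).
Qed.

End Regions.

Lemma xarc_inj n (P P' : {set {set 'I_n}}) L L' :
  non_crossing P -> non_crossing P' -> levels_ok P L -> levels_ok P' L' ->
  (forall p q, xarc P L p q <-> xarc P' L' p q) -> P = P' /\ L =1 L'.
Proof.
move=> ncP ncP' okL okL' eX; split=> [|i]; last first.
  apply: level_ext => k; apply/idP/idP => /xarc_line.
    by move=> /(_ _ ncP)/eX/xarc_below.
  by move=> /(_ _ ncP')/eX/xarc_below.
have [partP _] := ncP; have [partP' _] := ncP'.
rewrite -(finset.equivalence_partition_pblock partP) -(finset.equivalence_partition_pblock partP').
apply: eq_imset => i /=; apply/setP => j; rewrite !inE /=.
have [<-|/eqP ij] := eqVneq i j.
  by rewrite !finset.mem_pblock !(finset.cover_partition partP) !(finset.cover_partition partP').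
apply/idP/idP.
  move=> /(xarc_pblock ncP okL ij)[k [l /eX kl]].
  by apply/(xarc_pblock ncP' okL' ij); exists k, l.
move=> /(xarc_pblock ncP' okL' ij)[k [l /eX kl]].
by apply/(xarc_pblock ncP okL ij); exists k, l.
Qed.

(** * Sets of arcs closed under shifts and exchange *)

Section Ptolemy.
Context {n : nat} (X : ('I_n * int)%type -> ('I_n * int)%type -> Prop).
Notation pt := ('I_n * int)%type.
Implicit Types (p q r s : pt) (i j h : 'I_n) (k l m : int).

(** One side of the quadrilateral suffices in [Xext]: [ccross] does not depend on the naming of
    endpoints, so [Xsym] yields the others. *)
Hypotheses (Xsym : forall p q, X p q -> X q p)
  (Xarc : forall p q, X p q -> carc p q)
  (Xshift : forall p q, X p q -> X (shp (-1) p) (shp (-1) q))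
  (Xext : forall p q r s, X p q -> X r s -> ccross p q r s -> carc p r -> X p r).

Let covered p := exists q, X p q.

Let linked i j := i <> j /\ exists k l, X (i, k) (j, l).

Lemma carc_lines i j k l : i <> j -> carc (i, k) (j, l).
Proof.
move=> ij; rewrite /carc !eqpE /=.
by have /negbTE -> : j != i :> nat by apply/eqP => /val_inj /esym.
Qed.

(** Each step exchanges the arc with its suspension; the side taken joins the shifted endpoint to
    the unshifted [q]. *)
Lemma ptolemy_lower i k q (N : nat) : X (i, k) q ->
  (forall k', k - N%:Z <= k' <= k -> carc (i, k') q) -> X (i, k - N%:Z) q.
Proof.
elim: N => [|N IHN] Xq arcs; first by rewrite subr0.
have {IHN}XN : X (i, k - N%:Z) q by apply: IHN => // k' kk; apply: arcs; lia.
have -> : (i, k - N.+1%:Z) = shp (-1) (i, k - N%:Z) :> pt.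
  by rewrite /shp /=; congr pair; lia.
apply: (Xext (Xshift XN) (Xsym XN)).
  by have := ccross_sym (ccross_shift (Xarc XN)); rewrite /ccross orbC.
by rewrite /shp /=; apply: arcs; lia.
Qed.

Lemma ptolemy_lower2 i j k l k' l' : i <> j -> X (i, k) (j, l) ->
  k' <= k -> l' <= l -> X (i, k') (j, l').
Proof.
move=> ij Xij k'k l'l.
have {}Xij : X (i, k') (j, l).
  have -> : k' = k - `|k - k'|%N%:Z by lia.
  by apply: ptolemy_lower => // *; exact: carc_lines.
have -> : l' = l - `|l - l'|%N%:Z by lia.
by apply/Xsym/ptolemy_lower => [|*]; [exact: Xsym|apply: carc_lines; exact: nesym].
Qed.

Lemma carc_line i k l : carc (i, k) (i, l) = [&& l != k, l != k + 1 & l != k - 1].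
Proof. by rewrite /carc !eqpE /= eqxx /= !negb_or. Qed.

(** Lowering the lower endpoint first keeps the two endpoints at distance at least 2 throughout. *)
Lemma ptolemy_lower_line i (s t : int) k l : X (i, s) (i, t) -> s < t -> l <= s -> k <= t ->
  l <= k - 2 -> X (i, k) (i, l).
Proof.
move=> Xst st ls kt lk; have := Xarc Xst; rewrite carc_line => arc.
have {}Xst : X (i, l) (i, t).
  have -> : l = s - `|s - l|%N%:Z by lia.
  by apply: ptolemy_lower => // k' kk; rewrite carc_line; lia.
have -> : k = t - `|t - k|%N%:Z by lia.
by apply: ptolemy_lower => [|k' kk]; [exact: Xsym|rewrite carc_line; lia].
Qed.

Lemma ptolemy_line i k0 k l : covered (i, k0) -> k <= k0 -> l <= k - 2 ->
  X (i, k) (i, l).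
Proof.
move=> [[j m] Xq] kk0 lk.
have [ij|/eqP ij] := eqVneq i j; last first.
  have X1 : X (i, k) (j, m) by apply: ptolemy_lower2 Xq _ _ => //.
  (* Lowering [m] as well makes the two arcs towards line [j] cross; the exchanged side lies inside
     line [i]. *)
  have X2 : X (i, l) (j, m - 1) by apply: ptolemy_lower2 Xq _ _ => //; lia.
  apply: (Xext X1 X2); last by rewrite carc_line; lia.
  have ij' : i <> j :> nat by move/val_inj.
  have [lt|lt|//] := ltngtP (i : nat) j; apply/orP; [right|right];
    apply/andP; split; rewrite /ccyc /ltp /=; lia.
subst j; have := Xarc Xq; rewrite carc_line => arc.
(* The lower endpoint [s] can be passed by exchanging with a shifted arc. *)
have line (s t : int) : X (i, s) (i, t) -> s < t -> k <= t -> X (i, k) (i, l).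
  move=> Xst st kt; have := Xarc Xst; rewrite carc_line => arc'.
  have [ls|sl] := leP l s; first exact: ptolemy_lower_line Xst st ls kt lk.
  have X1 : X (i, k) (i, s) by apply: ptolemy_lower_line Xst st _ kt _; lia.
  have X2 : X (i, l) (i, s - 1) by apply: ptolemy_lower_line Xst st _ _ _; lia.
  apply: (Xext X1 X2); last by rewrite carc_line; lia.
  apply/orP; right; apply/andP; split; rewrite /ccyc /ltp /= ltnn eqxx /=; lia.
have [km|mk] := leP k0 m.
  by apply: (line k0 m) => //; lia.
by apply: (line m k0) => //; [exact: Xsym].
Qed.

Lemma covered_le i k l : l <= k -> covered (i, k) -> covered (i, l).
Proof. by move=> lk ck; exists (i, l - 2); exact: ptolemy_line ck lk _. Qed.

Lemma linked_sym i j : linked i j -> linked j i.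
Proof.
by move=> [ij [k [l Xij]]]; split; [exact: nesym|exists l, k; exact: Xsym].
Qed.

(** The arc from [(i, k)] to [(i, k0 - 1)] spans [(i, k0)], so it crosses the linking arc, and
    exchange lifts the endpoint to [(i, k)]. *)
Lemma linked_raise i j k k0 l0 : i <> j -> X (i, k0) (j, l0) -> covered (i, k) ->
  X (i, k) (j, l0).
Proof.
move=> ij Xij ck; have [kk|kk] := leP k k0; first exact: ptolemy_lower2 Xij kk _.
have X1 : X (i, k) (i, k0 - 1) by apply: ptolemy_line ck _ _ => //; lia.
apply: (Xext X1 (Xsym Xij)); last exact: carc_lines.
have ij' : i <> j :> nat by move/val_inj.
have [lt|lt|//] := ltngtP (i : nat) j; apply/orP; [left|left];
  apply/andP; split; rewrite /ccyc /ltp /=; lia.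
Qed.

Lemma linked_all i j k l : linked i j -> covered (i, k) -> covered (j, l) ->
  X (i, k) (j, l).
Proof.
move=> [ij [k0 [l0 Xij]]] ck cl.
apply/Xsym/(linked_raise (nesym ij) _ cl)/Xsym.
exact: linked_raise Xij ck.
Qed.

Lemma linked_trans i j h : linked i j -> linked j h -> i <> h -> linked i h.
Proof.
move=> [ij [k [l Xij]]] [jh [l2 [m Xjh]]] ih; split=> //; exists k, m.
pose l' := Num.min l l2.
have l'l : l' <= l by rewrite /l' ge_min lexx.
have l'l2 : l' <= l2 by rewrite /l' ge_min lexx orbT.
have X1 b : 0 <= b -> X (i, k) (j, l' - b).
  by move=> b0; apply: ptolemy_lower2 Xij _ _ => //; lia.
have X2 b : 0 <= b -> X (h, m) (j, l' - b).
  move=> b0; apply/Xsym.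
  by apply: ptolemy_lower2 Xjh _ _ => //; lia.
have ij' : i <> j :> nat by move/val_inj.
have jh' : j <> h :> nat by move/val_inj.
have ih' : i <> h :> nat by move/val_inj.
(* Both arcs end on line [j]; which of them must end lower in order to cross depends on the cyclic
   order of [i], [j], [h]. *)
have [c|c] : ccross (i, k) (j, l' - 0) (h, m) (j, l' - 1) \/
    ccross (i, k) (j, l' - 1) (h, m) (j, l' - 0).
  rewrite /ccross /ccyc4 /ccyc /ltp /=.
  by have [a|a|//] := ltngtP (i : nat) j; have [b|b|//] := ltngtP (i : nat) h;
    have [c|c|//] := ltngtP (j : nat) h; lia.
- by apply: Xext (X1 0 _) (X2 1 _) c _ => //; exact: carc_lines.
- by apply: Xext (X1 1 _) (X2 0 _) c _ => //; exact: carc_lines.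
Qed.

Lemma linked_noncrossing (i h j g : 'I_n) : (i < h)%N -> (h < j)%N -> (j < g)%N ->
  linked i j -> linked h g -> linked i h.
Proof.
move=> ih hj jg [ij [k [l Xij]]] [hg [m [m' Xhg]]].
have ih' : i <> h by move=> e; rewrite e ltnn in ih.
split=> //; exists k, m; apply: Xext Xij Xhg _ _; last exact: carc_lines.
by apply/orP; left; apply/andP; split; rewrite /ccyc /ltp /=; lia.
Qed.

(** Exchange does not imply this: all arcs inside a single segment satisfy the other hypotheses. It
    is supplied by [aisle_next]. *)
Hypothesis Xnext : forall i, n <> 1%N -> (forall k, covered (i, k)) ->
  linked i (ordS i).

(** Blocks are the classes of linking made reflexive; the level of a line is the downward closed set
    of its covered points. *)
Lemma ptolemy_shape : exists (P : {set {set 'I_n}}) (L : 'I_n -> level),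
  [/\ non_crossing P, levels_ok P L & forall p q, X p q <-> xarc P L p q].
Proof.
pose rel i j := (i == j) || `[< linked i j >].
have relP i j : reflect (i = j \/ linked i j) (rel i j).
  by apply: (iffP orP) => -[/eqP|/asboolP]; [left|right|left|right] => //; exact/asboolP.
have eqrel : {in [set: 'I_n]%SET & &, equivalence_rel rel}.
  move=> i j h _ _ _; split; first by rewrite /rel eqxx.
  have rsym a b : rel a b -> rel b a.
    by move/relP=> [->|/linked_sym ba]; apply/relP; [left|right].
  have rtrans a b c : rel a b -> rel b c -> rel a c.
    move=> /relP[->//|ab] /relP[<-|bc]; first by apply/relP; right.
    apply/relP; have [|ac] := pselect (a = c); [by left|right].
    exact: linked_trans ab bc ac.
  by move=> ij; apply/idP/idP; apply: rtrans => //; exact: rsym.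
pose P := finset.equivalence_partition rel [set: 'I_n]%SET.
have partP : finset.partition P [set: 'I_n]%SET := finset.equivalence_partitionP eqrel.
have pblP i j : (j \in finset.pblock P i) = rel i j.
  by rewrite (finset.pblock_equivalence_partition eqrel) ?finset.in_setT.
have /and3P[/eqP covP trivP _] := partP.
have blockP B i j : B \in P -> i \in B -> j \in B -> rel i j.
  by move=> PB iB jB; rewrite -pblP (def_pblock trivP PB iB).
have pblm i : finset.pblock P i \in P.
  by apply: finset.pblock_mem; rewrite covP finset.in_setT.
have ipbl i : i \in finset.pblock P i.
  by rewrite pblP /rel eqxx.
have [L covL] := choice (fun i => level_of (fun k l => @covered_le i k l)).
have noncr (B1 B2 : {set 'I_n}) (i h j g : 'I_n) : B1 \in P -> B2 \in P ->
  (i < h)%N -> (h < j)%N -> (j < g)%N ->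
  i \in B1 -> j \in B1 -> h \in B2 -> g \in B2 -> B1 = B2.
  move=> P1 P2 ih hj jg i1 j1 h2 g2.
  have [e|lij] := relP _ _ (blockP _ _ _ P1 i1 j1).
    by rewrite e in ih; have := ltn_trans ih hj; rewrite ltnn.
  have [e|lhg] := relP _ _ (blockP _ _ _ P2 h2 g2).
    by rewrite e in hj; have := ltn_trans hj jg; rewrite ltnn.
  have lih := linked_noncrossing ih hj jg lij lhg.
  have : h \in finset.pblock P i by rewrite pblP; apply/relP; right.
  rewrite (def_pblock trivP P1 i1) => h1.
  by rewrite -(def_pblock trivP P1 h1) (def_pblock trivP P2 h2).
exists P, L; split=> [|i|p q]; first by [].
- split=> Li.
    have : finset.pblock P i = [set i]%SET.
      apply/setP => j; rewrite pblP finset.in_set1 eq_sym.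
      apply/relP/eqP => [[//|[_ [k [l Xij]]]]|]; last by left.
      have : covered (i, k) by exists (j, l).
      by move/covL; rewrite Li.
    by rewrite /singleton => <-; exact: pblm.
  have [n1|n1] := pselect (n = 1%N); [by left|right].
  have lnk : linked i (ordS i).
    by apply: Xnext => // k; apply/covL; rewrite Li.
  apply/existsP; exists (finset.pblock P i); rewrite pblm ipbl pblP /=.
  by apply/relP; right.
- case: p q => [i k] [j l]; split=> [Xpq|[arc [B PB /andP[/andP[/= iB kL] /andP[/= jB lL]]]]].
    split; first exact: Xarc.
    exists (finset.pblock P i) => //; rewrite /region /= ipbl /= pblP.
    apply/and3P; split; [by apply/covL; exists (j, l)| |by apply/covL; exists (i, k); exact: Xsym].
    apply/relP; have [|ij] := pselect (i = j); [by left|right].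
    by split=> //; exists k, l.
  move/covL: kL => kL; move/covL: lL => lL.
  have [ij|lij] := relP _ _ (blockP _ _ _ PB iB jB); last exact: linked_all.
  subst j; move: arc; rewrite carc_line => arc.
  have [lk|kl] := leP l k; first by apply: ptolemy_line kL _ _ => //; lia.
  by apply/Xsym; apply: ptolemy_line lL _ _ => //; lia.
Qed.

End Ptolemy.

(** * Angles *)

Section Angles.
Context {R : realType}.
Implicit Types (x y z p : plane R) (s t u al : R).

Notation tau := (pi *+ 2 : R).

Lemma tau_gt0 : 0 < tau.
Proof. by rewrite pmulrn_lgt0 ?pi_gt0. Qed.

Lemma circle_ptD t : circle_pt (t + tau) = circle_pt t.
Proof. by rewrite /circle_pt cosD2pi sinD2pi. Qed.

Lemma circle_ptDz t (k : int) : circle_pt (t + tau *~ k) = circle_pt t.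
Proof.
have aux s m : circle_pt (s + tau *+ m) = circle_pt s.
  by rewrite /circle_pt (periodicn (@cosD2pi R)) (periodicn (@sinD2pi R)).
case: k => m; first exact: aux.
by rewrite -[in RHS](subrK (tau *+ m.+1) t) aux.
Qed.

(** The cosine of [s - t] is 1, so the sine of half the difference vanishes, and that half has
    absolute value below pi. *)
Lemma circle_pt_inj s t : `|s - t| < tau -> circle_pt s = circle_pt t -> s = t.
Proof.
move=> st [cst sst]; apply/eqP; rewrite -subr_eq0; apply/eqP.
have half : (s - t) / 2 *+ 2 = s - t by rewrite -mulr_natr divfK ?pnatr_eq0.
have cos1 : cos (s - t) = 1.
  by rewrite cosB cst sst -!expr2 cos2Dsin2.
have sin0 : sin ((s - t) / 2) = 0.
  have : sin ((s - t) / 2) ^+ 2 = 0.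
    rewrite sin2cos2; move: cos1; rewrite -half cos_mulr2n half => h.
    by move: h; lra.
  by move/eqP; rewrite sqrf_eq0 => /eqP.
move: st; rewrite ltr_norml => /andP[lo hi].
have [pos|neg|//] := ltgtP 0 (s - t).
- have : 0 < sin ((s - t) / 2) by apply: sin_gt0_pi; move: hi; lra.
  by rewrite sin0 ltxx.
- have : 0 < sin (- ((s - t) / 2)) by apply: sin_gt0_pi; move: lo; lra.
  by rewrite sinN sin0 oppr0 ltxx.
Qed.

Lemma unit_circle_pt t : unit_circle (circle_pt t).
Proof. exact: cos2Dsin2. Qed.

Lemma circle_pt_surj p : unit_circle p -> exists t, circle_pt t = p.
Proof.
case: p => x y; rewrite /unit_circle /= => xy.
have x1 : -1 <= x <= 1.
  have : x ^+ 2 <= 1 by rewrite -xy lerDl sqr_ge0.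
  by move=> x2; apply/andP; split; nra.
have cx : cos (acos x) = x by rewrite acosK.
have sx : sin (acos x) = `|y|.
  by rewrite sin_acos // -xy addrAC subrr add0r sqrtr_sqr.
have [y0|y0] := leP 0 y.
  by exists (acos x); rewrite /circle_pt cx sx ger0_norm.
by exists (- acos x); rewrite /circle_pt cosN sinN cx sx ltr0_norm ?opprK.
Qed.

Section Cut.
Context (al : R).

Definition angle p : R :=
  xget al [set t | al <= t < al + tau /\ circle_pt t = p].

Lemma angleP p : unit_circle p ->
  al <= angle p < al + tau /\ circle_pt (angle p) = p.
Proof.
move=> /circle_pt_surj[s <-].
apply: (@xgetPex _ al [set t | al <= t < al + tau /\ circle_pt t = circle_pt s]).
pose m := Num.floor ((s - al) / tau); exists (s + tau *~ (- m)); split; last first.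
  exact: circle_ptDz.
have t0 := tau_gt0.
have e : s - al = (s - al) / tau * tau by rewrite divfK // gt_eqF.
have /andP[lo hi] : m%:~R <= (s - al) / tau < (m + 1)%:~R by exact: floor_itv.
rewrite mulrNz -mulrzl; apply/andP; split.
  rewrite -subr_ge0 addrAC e -mulrBl mulr_ge0 ?(ltW t0) // subr_ge0.
  by exact: lo.
rewrite -subr_gt0 opprB.
have -> : al + tau + (m%:~R * tau - s) = ((m + 1)%:~R - (s - al) / tau) * tau.
  by rewrite mulrBl -e intrD mulrDl mul1r; ring.
by rewrite mulr_gt0 // subr_gt0.
Qed.

Lemma angle_circle_pt t : al <= t < al + tau -> angle (circle_pt t) = t.
Proof.
move=> /andP[lo hi]; have [/andP[lo' hi'] e] := angleP (unit_circle_pt t).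
by apply: circle_pt_inj e; rewrite ltr_norml; apply/andP; split; lra.
Qed.

Lemma angle_inj p q : unit_circle p -> unit_circle q -> angle p = angle q -> p = q.
Proof. by move=> /angleP[_ ep] /angleP[_ eq] e; rewrite -ep -eq e. Qed.

Definition rot3 (s t u : R) := [|| s < t < u, t < u < s | u < s < t].

Lemma cycP x y z : cyc x y z <-> [/\ unit_circle x, unit_circle y, unit_circle z
  & rot3 (angle x) (angle y) (angle z)].
Proof.
have t0 := tau_gt0; split; last first.
  move=> [ux uy uz]; have [/andP[xl xh] ex] := angleP ux.
  have [/andP[yl yh] ey] := angleP uy; have [/andP[zl zh] ez] := angleP uz.
  case/or3P=> /andP[a b].
  - by exists (angle x), (angle y), (angle z); split=> //; lra.
  - exists (angle x), (angle y + tau), (angle z + tau).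
    by rewrite !circle_ptD; split=> //; lra.
  - exists (angle x), (angle y), (angle z + tau).
    by rewrite !circle_ptD; split=> //; lra.
move=> [s [t [u [st tu us [-> -> ->]]]]].
split; try exact: unit_circle_pt.
wlog /andP[lo hi] : s t u st tu us / al <= s < al + tau.
  have [/andP[lo hi] e] := angleP (unit_circle_pt s).
  (* [d] is a multiple of a full turn; its sine and cosine are all that is needed to move the triple
     so that [s] lies in the chosen period. *)
  pose d := angle (circle_pt s) - s.
  have ed v : circle_pt (v + d) = circle_pt v.
    have [c1 s1] := e.
    have cd : cos d = 1 by rewrite cosB c1 s1 -!expr2 cos2Dsin2.
    have sd : sin d = 0 by rewrite sinB c1 s1 mulrC subrr.
    by rewrite /circle_pt cosD sinD cd sd !mulr0 !mulr1 subr0 addr0.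
  move=> /(_ (s + d) (t + d) (u + d)); rewrite !ed; apply.
  - by rewrite ltrD2r.
  - by rewrite ltrD2r.
  - by rewrite addrAC ltrD2r.
  - by rewrite /d addrC subrK lo hi.
rewrite (angle_circle_pt (t := s)) ?lo ?hi //.
(* Within one turn after [s] the angle wraps at most once. *)
have ang v : s < v -> v < s + tau ->
    angle (circle_pt v) = if v < al + tau then v else v - tau.
  move=> sv vs; case: ifP => [vh|/negbT].
    by rewrite angle_circle_pt // vh andbT; lra.
  rewrite -leNgt => vh.
  have -> : circle_pt v = circle_pt (v - tau) by rewrite -(circle_ptD (v - tau)) subrK.
  by rewrite angle_circle_pt //; lra.
rewrite !ang; try lra.
rewrite /rot3; case: ifP => [tl|/negbT]; case: ifP => [ul|/negbT]; rewrite -?leNgt; lra.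
Qed.

End Cut.

Lemma cont_circle_pt c (U : set (plane R)) : nbhs (circle_pt c) U ->
  exists2 e, 0 < e & forall t, `|t - c| < e -> U (circle_pt t).
Proof.
move=> -[[A B] /= [cA sB] AB].
have : nbhs c ((@cos R @^-1` A) `&` (@sin R @^-1` B)).
  by apply: filterI; [exact: continuous_cos cA|exact: continuous_sin sB].
move=> /nbhs_ballP[e /= e0 eU]; exists e => // t tc.
have [tA tB] : ((@cos R @^-1` A) `&` (@sin R @^-1` B)) t.
  by apply: eU; rewrite /ball /= distrC.
by apply: AB; split.
Qed.

Lemma closure_unit_circle (Z : set (plane R)) :
  Z `<=` unit_circle -> closure Z `<=` unit_circle.
Proof.
move=> Zu; have clu : closed (@unit_circle R).
  rewrite (_ : unit_circle = (fun p : plane R => p.1 ^+ 2 + p.2 ^+ 2) @^-1` [set 1]) //.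
  apply: closed_comp => [p _|]; last exact: closed_eq.
  by apply: cvgD; apply: cvgM; (exact: cvg_fst || exact: cvg_snd).
by rewrite [X in _ `<=` X](closure_id _).1 //; exact: closureS.
Qed.

End Angles.

(** * Coordinates on the admissible set *)

Section Coordinates.
Context {R : realType} {n : nat} (n_gt0 : (0 < n)%N).
Context (Z : set (plane R)) (admZ : admissible Z n).
Context (a : 'I_n -> plane R) (enumA : limit_enumeration Z a).
Implicit Types (z w c p : plane R) (i j : 'I_n) (k : int).

Notation tau := (pi *+ 2 : R).

Let i0 : 'I_n := Ordinal n_gt0.

Let Z_circle z : Z z -> unit_circle z.
Proof. by case: admZ => Zc _ _ _ _; exact: Zc. Qed.

Let limit_a i : limit_pts Z (a i).
Proof. by case: enumA => _ <- _; exists i. Qed.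

Let a_circle i : unit_circle (a i).
Proof. by apply: (closure_unit_circle Z_circle); case: (limit_a i). Qed.

Let a_notin i : ~ Z (a i).
Proof. by case: (limit_a i). Qed.

(** Cutting at a limit point leaves every segment of [Z] inside one interval of angles. *)
Let cut : R := xget 0 [set t | circle_pt t = a i0].

Let cutE : circle_pt cut = a i0.
Proof. by apply: (@xgetPex _ 0 [set t | circle_pt t = a i0]); exact: circle_pt_surj. Qed.

Local Notation th := (angle cut).

Let th_bound p : unit_circle p -> cut <= th p < cut + tau.
Proof. by move=> /(angleP cut)[]. Qed.

Let th_a0 : th (a i0) = cut.
Proof. by rewrite -cutE angle_circle_pt // lexx ltrDl tau_gt0. Qed.

Let th_gt z : Z z -> cut < th z.
Proof.
move=> Zz; have /andP[+ _] := th_bound (Z_circle Zz); rewrite le_eqVlt => /orP[/eqP e|//].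
case: (@a_notin i0); rewrite -(@angle_inj _ cut z (a i0)) ?th_a0 //; exact: Z_circle.
Qed.

Let cyc_th x y z : unit_circle x -> unit_circle y -> unit_circle z ->
  cyc x y z <-> rot3 (th x) (th y) (th z).
Proof. by move=> ux uy uz; split=> [/(cycP cut)[]|h] //; apply/(cycP cut). Qed.

Let th_a_lt i j : (i < j)%N -> th (a i) < th (a j).
Proof.
case: enumA => inja _ cyca ij.
have a0 (h : 'I_n) : (0 < h)%N -> cut < th (a h).
  move=> h0; have /andP[+ _] := th_bound (a_circle h); rewrite le_eqVlt => /orP[/eqP e|//].
  have /inja e' : a h = a i0 by apply: (@angle_inj _ cut); rewrite ?th_a0.
  by rewrite e' in h0.
have [i_0|i_gt0] := posnP i.
  have -> : i = i0 by apply: val_inj.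
  by rewrite th_a0 a0 //; exact: leq_ltn_trans ij.
have /(cycP cut)[_ _ _] := cyca i0 i j i_gt0 ij.
have h1 := a0 _ i_gt0; have h2 := a0 _ (ltn_trans i_gt0 ij).
by rewrite th_a0 /rot3; lra.
Qed.

Let th_a_le i j : (i <= j)%N -> th (a i) <= th (a j).
Proof.
by rewrite leq_eqVlt => /orP[/eqP/val_inj ->//|/th_a_lt/ltW].
Qed.

(* The last segment ends at the cut. *)
Let rend i : R := if insub i.+1 is Some j then th (a j) else cut + tau.

Let rend_le i j : (i < j)%N -> rend i <= th (a j).
Proof.
move=> ij; rewrite /rend; case: insubP => [h _ hi|]; first by apply: th_a_le; rewrite hi.
by have := ltn_ord j; lia.
Qed.

Let rend_cut i : rend i <= cut + tau.
Proof.
rewrite /rend; case: insubP => [h _ _|_ //].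
by case/andP: (th_bound (a_circle h)) => _ /ltW.
Qed.

Let a_lt_rend i : th (a i) < rend i.
Proof.
rewrite /rend; case: insubP => [h _ hi|_]; first by apply: th_a_lt; rewrite hi.
by case/andP: (th_bound (a_circle i)).
Qed.

Let gap_limit i (c : R) j : th (a i) < c -> c < rend i -> circle_pt c <> a j.
Proof.
move=> ic ci e; have c_range : cut <= c < cut + tau.
  have /andP[h _] := th_bound (a_circle i); have := rend_cut i.
  by move: ic ci h; lra.
have {}e : th (a j) = c by rewrite -e angle_circle_pt.
have [ij|ji] := ltnP i j; first by have := rend_le ij; rewrite e leNgt ci.
by have := th_a_le ji; rewrite e leNgt ic.
Qed.

(** The point at angle [c] is in the closure of [Z], and not in [Z], whose points are isolated. The
    bound [tau] in the proof lets [circle_pt_inj] identify angles. *)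
Let limit_angle (c : R) : (forall e, 0 < e -> exists2 w, Z w & 0 < `|th w - c| < e) ->
  exists j, circle_pt c = a j.
Proof.
move=> acc; case: admZ => _ iso _ _ _; case: enumA => _ ra _.
have : limit_pts Z (circle_pt c).
  split=> [U /cont_circle_pt[e e0 eU]|Zc].
    have [w Zw /andP[_ we]] := acc e e0; exists w; split=> //.
    have [_ <-] := angleP cut (Z_circle Zw); exact: eU.
  have [_ [U /cont_circle_pt[e e0 eU] UZ]] := iso _ Zc.
  have [|w Zw /andP[w0 we]] := acc (Num.min e tau); first by rewrite lt_min e0 tau_gt0.
  have [_ ew] := angleP cut (Z_circle Zw).
  have : (U `&` Z) w.
    by split=> //; rewrite -ew; apply: eU; move: we; rewrite lt_min => /andP[].
  rewrite UZ /= => e'; have : th w = c.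
    by apply: circle_pt_inj; [move: we; rewrite lt_min => /andP[]|rewrite ew].
  by move=> e''; move: w0; rewrite e'' subrr normr0 ltxx.
by rewrite -ra => -[j _ <-]; exists j.
Qed.

(** An infimum that is not attained would be an accumulation point, hence a limit point strictly
    inside the gap, against [gap_limit]. *)
Let seg_min i (T : set (plane R)) (lo hi : R) : th (a i) < lo -> hi < rend i ->
  T !=set0 -> (forall z, T z -> Z z /\ lo <= th z <= hi) ->
  exists2 z, T z & forall w, T w -> th z <= th w.
Proof.
move=> alo hir [z0 Tz0] Tsub; pose S := [set th z | z in T].
have S0 : S !=set0 by exists (th z0), z0.
have lbS : lbound S lo by move=> _ [z Tz <-]; case: (Tsub z Tz) => _ /andP[].
have hS : has_lbound S by exists lo.
have infS : lo <= inf S <= hi.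
  rewrite lb_le_inf //=; apply: le_trans (ge_inf hS _) _; first by exists z0.
  by case: (Tsub _ Tz0) => _ /andP[].
have [[z Tz ez]|noz] := pselect (S (inf S)).
  by exists z => // w Tw; rewrite ez; apply: ge_inf => //; exists w.
have [|j /gap_limit] := @limit_angle (inf S); last first.
  by move=> /(_ i); case/andP: infS => h1 h2; case; lra.
move=> e e0; have [|_ [w Tw <-] we] := @inf_adherent _ S e e0; first by split.
exists w; first by case: (Tsub w Tw).
have : inf S <= th w by apply: ge_inf => //; exists w.
rewrite le_eqVlt => /orP[/eqP e'|lt]; first by case: noz; exists w.
by rewrite gtr0_norm subr_gt0 // lt /= ltrBlDl.
Qed.

Let seg_max i (T : set (plane R)) (lo hi : R) : th (a i) < lo -> hi < rend i ->
  T !=set0 -> (forall z, T z -> Z z /\ lo <= th z <= hi) ->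
  exists2 z, T z & forall w, T w -> th w <= th z.
Proof.
move=> alo hir [z0 Tz0] Tsub; pose S := [set th z | z in T].
have S0 : S !=set0 by exists (th z0), z0.
have ubS : ubound S hi by move=> _ [z Tz <-]; case: (Tsub z Tz) => _ /andP[].
have hS : has_ubound S by exists hi.
have supS : lo <= sup S <= hi.
  apply/andP; split; last exact: ge_sup.
  apply: le_trans (ub_le_sup hS _); last by exists z0.
  by case: (Tsub _ Tz0) => _ /andP[].
have [[z Tz ez]|noz] := pselect (S (sup S)).
  by exists z => // w Tw; rewrite ez; apply: ub_le_sup => //; exists w.
have [|j /gap_limit] := @limit_angle (sup S); last first.
  by move=> /(_ i); case/andP: supS => h1 h2; case; lra.
move=> e e0; have [|_ [w Tw <-] we] := @sup_adherent _ S e e0; first by split.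
exists w; first by case: (Tsub w Tw).
have : th w <= sup S by apply: ub_le_sup => //; exists w.
rewrite le_eqVlt => /orP[/eqP e'|lt]; first by case: noz; exists w.
by rewrite ltr0_norm ?subr_lt0 // opprB subr_gt0 lt /= ltrBlDl -ltrBlDr.
Qed.

Let seg i z := Z z /\ th (a i) < th z < rend i.

Let two_sided_a i : two_sided Z (a i).
Proof. by case: admZ => _ _ _ _; apply; exact: limit_a. Qed.

(** Points of [Z] accumulate at the right end of the segment from below; for the last segment this
    end is [a i0], seen one turn later. *)
Let seg_right i z : seg i z -> exists2 w, Z w & th z < th w < rend i.
Proof.
move=> [Zz /andP[az zr]]; have uz := Z_circle Zz; have cz := th_gt Zz.
move: zr; rewrite /rend; case: insubP => [h _ _|_] zh.
  have [|_ [w Zw]] := @two_sided_a h _ uz; first by move=> e; apply: (@a_notin h); rewrite -e.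
  move/cyc_th => /(_ uz (Z_circle Zw) (a_circle h)) p.
  by exists w => //; move: p; rewrite /rot3; lra.
have [|_ [w Zw]] := @two_sided_a i0 _ uz; first by move=> e; apply: (@a_notin i0); rewrite -e.
move/cyc_th => /(_ uz (Z_circle Zw) (a_circle i0)).
have cw := th_gt Zw; have /andP[_ wt] := th_bound (Z_circle Zw).
by rewrite th_a0 => p; exists w => //; move: p; rewrite /rot3; lra.
Qed.

Let seg_left i z : seg i z -> exists2 w, Z w & th (a i) < th w < th z.
Proof.
move=> [Zz /andP[az zr]]; have uz := Z_circle Zz.
have [|[w Zw] + _] := @two_sided_a i _ uz; first by move=> e; apply: (@a_notin i); rewrite -e.
move/cyc_th => /(_ (a_circle i) (Z_circle Zw) uz) p.
by exists w => //; move: p; rewrite /rot3; lra.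
Qed.

Let next_unique z w w' : next_to Z z w -> next_to Z z w' -> w = w'.
Proof.
move=> [Zz Zw zw nw] [_ Zw' zw' nw']; apply: (@angle_inj _ cut); try exact: Z_circle.
have uz := Z_circle Zz; have uw := Z_circle Zw; have uw' := Z_circle Zw'.
have thzw : th z <> th w by move=> e; apply: zw; exact: angle_inj e.
have thzw' : th z <> th w' by move=> e; apply: zw'; exact: angle_inj e.
have {}nw : ~ rot3 (th z) (th w') (th w) by move/cyc_th => /(_ uz uw' uw); exact: nw.
have {}nw' : ~ rot3 (th z) (th w) (th w') by move/cyc_th => /(_ uz uw uw'); exact: nw'.
by move/negP: nw; move/negP: nw'; move/eqP: thzw; move/eqP: thzw'; rewrite /rot3; lra.
Qed.

Let next_unique_left z z' w : next_to Z z w -> next_to Z z' w -> z = z'.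
Proof.
move=> [Zz Zw zw nw] [Zz' _ zw' nw']; apply: (@angle_inj _ cut); try exact: Z_circle.
have uz := Z_circle Zz; have uw := Z_circle Zw; have uz' := Z_circle Zz'.
have thzw : th z <> th w by move=> e; apply: zw; exact: angle_inj e.
have thzw' : th z' <> th w by move=> e; apply: zw'; exact: angle_inj e.
have {}nw : ~ rot3 (th z) (th z') (th w) by move/cyc_th => /(_ uz uz' uw); exact: nw.
have {}nw' : ~ rot3 (th z') (th z) (th w) by move/cyc_th => /(_ uz' uz uw); exact: nw'.
by move/negP: nw; move/negP: nw'; move/eqP: thzw; move/eqP: thzw'; rewrite /rot3; lra.
Qed.

Let next_th z w : Z z -> Z w -> th z < th w ->
  (forall c, Z c -> th z < th c -> th w <= th c) -> next_to Z z w.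
Proof.
move=> Zz Zw zw min; split=> // [e|c Zc /(cycP cut)[_ _ _]]; first by rewrite e ltxx in zw.
by have := min c Zc; rewrite /rot3; case: ltP => [_ /(_ isT)|_ _]; lra.
Qed.

Let zsuccE z w : next_to Z z w -> zsucc Z z = w.
Proof.
by move=> zw; apply: xget_unique => // w' zw'; exact: next_unique zw' zw.
Qed.

Let zpredE z w : next_to Z z w -> zpred Z w = z.
Proof.
by move=> zw; apply: xget_unique => // z' zw'; exact: next_unique_left zw' zw.
Qed.

Let seg_next i z : seg i z -> exists w, [/\ seg i w, next_to Z z w, th z < th w
   & forall c, Z c -> th z < th c -> th w <= th c].
Proof.
move=> sz; have [w0 Zw0 /andP[zw0 w0r]] := seg_right sz; have [Zz /andP[az zr]] := sz.
have [||w [Zw zw ww] wmin] := @seg_min i [set w | [/\ Z w, th z < th w & th w <= th w0]]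
    (th z) (th w0) az w0r.
- by exists w0.
- by move=> w [Zw zw ww]; split=> //; rewrite (ltW zw).
have min c : Z c -> th z < th c -> th w <= th c.
  move=> Zc zc; have [cw|/ltW wc] := leP (th c) (th w0); first exact: wmin.
  exact: le_trans wc.
exists w; split=> //; last exact: next_th.
by split=> //; rewrite (lt_trans az zw) (le_lt_trans ww).
Qed.

Let seg_prev i z : seg i z -> exists w, [/\ seg i w & zpred Z z = w /\ zsucc Z w = z].
Proof.
move=> sz; have [w0 Zw0 /andP[aw0 w0z]] := seg_left sz; have [Zz /andP[az zr]] := sz.
have [||w [Zw wz ww] wmax] := @seg_max i [set w | [/\ Z w, th w < th z & th w0 <= th w]]
    (th w0) (th z) aw0 zr.
- by exists w0.
- by move=> w [Zw wz ww]; split=> //; rewrite ww (ltW wz).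
have nx : next_to Z w z.
  apply: next_th => // c Zc wc; rewrite leNgt; apply/negP => cz.
  have : th c <= th w by apply: wmax; split=> //; apply: le_trans (ltW wc).
  by rewrite leNgt wc.
exists w; split; last by rewrite (zpredE nx) (zsuccE nx).
by split=> //; rewrite (lt_le_trans aw0 ww) (lt_trans wz).
Qed.

Let seg_exists i : exists z, seg i z.
Proof.
have ua := a_circle i; have := a_lt_rend i.
suff aux : th (a i) < rend i -> exists2 w, Z w & th (a i) < th w < rend i.
  by move=> /aux[w Zw aw]; exists w.
rewrite /rend; case: insubP => [h _ _|_] lt.
  have [|[w Zw] + _] := @two_sided_a i _ (a_circle h).
    by move=> e; rewrite e ltxx in lt.
  move/cyc_th => /(_ ua (Z_circle Zw) (a_circle h)) p.
  by exists w => //; move: p; rewrite /rot3; lra.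
(* Here the segment is the whole circle, and two-sidedness has no second limit point to be compared
   with; [Z] being infinite gives a point. *)
have [e|/eqP ne] := eqVneq i i0.
  have [w Zw] : exists w, Z w.
    by case: admZ => _ _ inf _ _; apply/set0P/eqP => Z0; apply: inf; rewrite Z0.
  by exists w => //; rewrite e th_a0 th_gt //=; case/andP: (th_bound (Z_circle Zw)).
have [|[w Zw] + _] := @two_sided_a i _ (a_circle i0).
  by case: enumA => inja _ _ /inja e; apply: ne; rewrite e.
move/cyc_th => /(_ ua (Z_circle Zw) (a_circle i0)) p.
exists w => //; have /andP[_ wt] := th_bound (Z_circle Zw); have cw := th_gt Zw.
by move: p; rewrite /rot3 th_a0; lra.
Qed.


Let seg_zsucc i z : seg i z -> [/\ seg i (zsucc Z z), th z < th (zsucc Z z),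
  zpred Z (zsucc Z z) = z & forall c, Z c -> th z < th c -> th (zsucc Z z) <= th c].
Proof.
by move=> /seg_next[w [sw zw lt min]]; rewrite (zsuccE zw); split=> //; exact: zpredE.
Qed.

Let base i := xget (a i) [set z | seg i z].

Let base_seg i : seg i (base i).
Proof. exact: (@xgetPex _ (a i) [set z | seg i z] (seg_exists i)). Qed.

Definition line i k : plane R := match k with
  | Posz m => iter m (zsucc Z) (base i)
  | Negz m => iter m.+1 (zpred Z) (base i) end.

Let line_seg i k : seg i (line i k).
Proof.
case: k => m; rewrite /line.
  by elim: m => [|m IHm]; [exact: base_seg|case: (seg_zsucc IHm)].
have prev z : seg i z -> seg i (zpred Z z) by case/seg_prev=> w [sw [-> _]].
by elim: m => [|m IHm]; [exact/prev/base_seg|exact: prev IHm].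
Qed.

Let line_zsucc i k : zsucc Z (line i k) = line i (k + 1).
Proof.
case: k => [m|m]; first by rewrite -PoszD addn1.
have -> : Negz m + 1 = - m%:Z by rewrite NegzE; lia.
have [w [sw [ew <-]]] := seg_prev (line_seg i (- m%:Z)); congr zsucc; rewrite -ew.
by case: m {sw ew} => // m; rewrite -NegzE.
Qed.

Let line_zpred i k : zpred Z (line i k) = line i (k - 1).
Proof.
by rewrite -[k in LHS](subrK 1) -line_zsucc; case: (seg_zsucc (line_seg i (k - 1))).
Qed.

Let line_lt i k l : k < l -> th (line i k) < th (line i l).
Proof.
move=> kl; have -> : l = k + (absz (l - k - 1)%R).+1%:Z by lia.
elim: (absz _) => [|m IHm].
  by rewrite -line_zsucc; case: (seg_zsucc (line_seg i k)).
have -> : k + m.+2%:Z = (k + m.+1%:Z) + 1 by lia.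
by rewrite -line_zsucc; case: (seg_zsucc (line_seg i (k + m.+1%:Z))) => _ /(lt_trans IHm).
Qed.

(** The extreme iterate on the near side of [z] exists by [seg_max] or [seg_min]; no point of [Z]
    lies between it and its neighbour, which forces equality with [z]. *)
Let line_surj i z : seg i z -> exists k, z = line i k.
Proof.
move=> sz; have [Zz /andP[az zr]] := sz.
have between k : th (line i k) <= th z -> th z < th (line i (k + 1)) -> z = line i k.
  rewrite le_eqVlt => /orP[/eqP e _|lt].
    by apply/esym; apply: (@angle_inj _ cut) => //; apply: Z_circle; case: (line_seg i k).
  rewrite -line_zsucc => ltz; have [_ _ _ /(_ z Zz lt)] := seg_zsucc (line_seg i k).
  by rewrite leNgt ltz.
have [bz|zb] := leP (th (line i 0)) (th z).
  have [|||_ [[k kz <-] b0] kmax] := @seg_max i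
     [set w | (exists2 k, th (line i k) <= th z & line i k = w) /\ th (line i 0) <= th w]
     (th (line i 0)) (th z) _ zr.
  - by case: (line_seg i 0) => _ /andP[].
  - by exists (line i 0); split=> //; exists 0.
  - by move=> _ [[k kz <-] bk]; rewrite kz bk; split=> //; case: (line_seg i k).
  exists k; apply: between => //; rewrite ltNge; apply/negP => kz1.
  have lt : th (line i k) < th (line i (k + 1)) by apply: line_lt; rewrite ltrDl.
  have := kmax (line i (k + 1)); rewrite leNgt lt => H; apply/notF/H; split.
    by exists (k + 1).
  exact: le_trans (ltW lt).
have [|||_ [[k kz <-] b0] kmin] := @seg_min i
   [set w | (exists2 k, th z <= th (line i k) & line i k = w) /\ th w <= th (line i 0)]
   (th z) (th (line i 0)) az.
- by case: (line_seg i 0) => _ /andP[].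
- by exists (line i 0); split=> //; exists 0 => //; exact: ltW.
- by move=> _ [[k kz <-] bk]; rewrite kz bk; split=> //; case: (line_seg i k).
have lt : th (line i (k - 1)) < th (line i k) by apply: line_lt; lia.
move: kz; rewrite le_eqVlt => /orP[/eqP e|kz].
  exists k; apply: (@angle_inj _ cut) => //; [exact: Z_circle|].
  by apply: Z_circle; case: (line_seg i k).
exists (k - 1); apply: between; rewrite ?subrK // leNgt; apply/negP => kz1.
have := kmin (line i (k - 1)); rewrite leNgt lt => H; apply/notF/H; split.
  by exists (k - 1) => //; exact: ltW.
exact: le_trans (ltW lt) b0.
Qed.

Let seg_cover z : Z z -> exists i, seg i z.
Proof.
move=> Zz; have iz0 : th (a i0) < th z by rewrite th_a0; exact: th_gt.
have [i iz imax] := @arg_maxnP _ i0 (fun i => th (a i) < th z) val iz0.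
exists i; split=> //; rewrite iz /= /rend; case: insubP => [h _ hi|_]; last first.
  by case/andP: (th_bound (Z_circle Zz)).
rewrite lt_neqAle; apply/andP; split.
  apply/eqP => /angle_inj e; apply: (@a_notin h); rewrite -e //; exact: Z_circle.
by rewrite leNgt; apply/negP => /imax /=; rewrite hi ltnn.
Qed.

Notation pt := ('I_n * int)%type.
Implicit Types q r s : pt.

Definition zpt q : plane R := line q.1 q.2.

Lemma point_in q : Z (zpt q).
Proof. by case: (line_seg q.1 q.2). Qed.

Lemma point_surj z : Z z -> exists q, z = zpt q.
Proof. by move=> /seg_cover[i /line_surj[k ->]]; exists (i, k). Qed.

Let th_point q r : ltp q r -> th (zpt q) < th (zpt r).
Proof.
case/orP=> [lt|/andP[/eqP/val_inj e lt]]; last first.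
  by rewrite /zpt e; exact: line_lt.
have [_ /andP[_ h1]] := line_seg q.1 q.2; have [_ /andP[h2 _]] := line_seg r.1 r.2.
by apply: lt_trans h1 (le_lt_trans (rend_le lt) h2).
Qed.

Let th_pointE q r : (th (zpt q) < th (zpt r)) = ltp q r.
Proof.
apply/idP/idP => [|/th_point//]; apply: contraTT => nlt; rewrite -leNgt.
have [e|ne] := eqVneq q r; first by rewrite e.
apply/ltW/th_point; move: nlt ne; rewrite /ltp eqpE.
by case: ltngtP => //= _; lia.
Qed.

Lemma point_inj : injective zpt.
Proof.
move=> q r e; have : ~~ ltp q r by rewrite -th_pointE e ltxx.
have : ~~ ltp r q by rewrite -th_pointE e ltxx.
move=> h1 h2; apply/eqP; move: h1 h2; rewrite /ltp eqpE.
by case: ltngtP => //= _; lia.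
Qed.

Lemma zsucc_point q : zsucc Z (zpt q) = zpt (shp 1 q).
Proof. exact: line_zsucc. Qed.

Lemma zpred_point q : zpred Z (zpt q) = zpt (shp (-1) q).
Proof. exact: line_zpred. Qed.

Let point_circle q : unit_circle (zpt q).
Proof. exact: Z_circle (point_in q). Qed.

Lemma cyc_point q r s : cyc (zpt q) (zpt r) (zpt s) <-> ccyc q r s.
Proof. by rewrite cyc_th // /rot3 !th_pointE. Qed.

Lemma ivcc_point q r s : ivcc Z (zpt q) (zpt r) (zpt s) <-> cin q s r.
Proof.
rewrite /ivcc /ivoo /cin /=; split.
  move=> [[_ /cyc_point ->//]|[/point_inj ->|/point_inj ->]]; rewrite eqxx ?orbT //.
case/or3P=> [/cyc_point h|/eqP ->|/eqP ->]; [left|right; left|right; right] => //.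
by split=> //; apply: subset_closure; exact: point_in.
Qed.

Lemma ivoc_point i k q : ivoc Z (a i) (zpt (i, k)) (zpt q) <-> q.1 = i /\ q.2 <= k.
Proof.
have [_ /andP[aik ikr]] := line_seg i k; have [Zq /andP[aq qr]] := line_seg q.1 q.2.
rewrite /ivoc /ivcc /ivoo /=; split.
  move=> [[[_ c]|[e|/point_inj ->]] _]; last by rewrite lexx.
    2: by case: (@a_notin i); rewrite -e.
  move/cyc_th: c => /(_ (a_circle i) (point_circle q) (point_circle _)) h.
  have {h} /andP[h1 h2] : th (a i) < th (zpt q) < th (zpt (i, k)).
    by move: h aik; rewrite /rot3 /zpt /=; lra.
  have iq : q.1 = i.
    apply/val_inj/eqP; rewrite eqn_leq; apply/andP; split; rewrite leqNgt; apply/negP => lt.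
      by have := lt_trans ikr (le_lt_trans (rend_le lt) aq); rewrite ltNge ltW.
    by have := lt_le_trans qr (rend_le lt); rewrite ltNge ltW.
  by split=> //; move: h2; rewrite th_pointE /ltp /= iq ltnn eqxx /= => /ltW.
move=> [qi qk]; split; last by move=> e; apply: (@a_notin i); rewrite -e.
move: qk; rewrite le_eqVlt => /orP[/eqP e|lt].
  by right; right; case: q qi e {Zq aq qr} => [j l] /= -> ->.
left; split; first by apply: subset_closure.
apply/cyc_th => //.
by rewrite /rot3 th_pointE /ltp qi /= ltnn eqxx lt -qi aq.
Qed.

Lemma ivoc_nil i : ivoc Z (a i) (a i) = set0.
Proof.
rewrite eqEsubset; split=> // p [[[_ /(cycP cut)[_ _ _]]|[]//]].
by rewrite /rot3; lra.
Qed.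

(** For [n = 1] the points [a i] and [a (ordS i)] coincide and the open interval between them is
    empty, hence the separate treatment. *)
Section ManyLimitPoints.
Hypothesis n_neq1 : n != 1%N.

Let rot3_next i p : unit_circle p ->
  rot3 (th (a i)) (th p) (th (a (ordS i))) = (th (a i) < th p < rend i).
Proof.
move=> /th_bound/andP[pl pr]; rewrite /rend.
case: insubP => [h _ hi|].
  have -> : ordS i = h by apply: val_inj; rewrite /= -hi modn_small //; exact: ltn_ord.
  have : th (a i) < th (a h) by apply: th_a_lt; rewrite hi.
  by rewrite /rot3; lra.
move=> hi; have e : i.+1 = n by have := ltn_ord i; lia.
have -> : ordS i = i0 by apply: val_inj; rewrite /= e modnn.
have : th (a i0) < th (a i) by apply: th_a_lt => /=; move/eqP: n_neq1; lia.
by rewrite th_a0 /rot3; lra.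
Qed.

Lemma cyc_next i q : cyc (a i) (zpt q) (a (ordS i)) <-> q.1 = i.
Proof.
have [Zq /andP[aq qr]] := line_seg q.1 q.2.
rewrite cyc_th ?rot3_next //; split=> [/andP[h1 h2]|<-]; last by rewrite aq qr.
apply/val_inj/eqP; rewrite eqn_leq; apply/andP; split; rewrite leqNgt; apply/negP => lt.
  by have := lt_trans h2 (le_lt_trans (rend_le lt) aq); rewrite ltxx.
by have := lt_trans qr (le_lt_trans (rend_le lt) h1); rewrite ltxx.
Qed.

Lemma ivoo_next i p : ivoo Z (a i) (a (ordS i)) p <-> exists k, p = zpt (i, k).
Proof.
split=> [[clp cp]|[k ->]]; last first.
  by split; [apply: subset_closure; exact: point_in|exact/cyc_next].
have [Zp|nZp] := pselect (Z p).
  have [q e] := point_surj Zp; subst p; move/cyc_next: cp => <-.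
  by exists q.2; rewrite -surjective_pairing.
have : limit_pts Z p by [].
case: enumA => _ <- _ [j _ e]; subst p; have /(cycP cut)[_ _ _] := cp.
rewrite rot3_next // => /andP[h1 h2]; exfalso.
by apply: (gap_limit h1 h2 (j := j)); case: (angleP cut (a_circle j)).
Qed.

Lemma ivoc_next i q : ivoc Z (a i) (a (ordS i)) (zpt q) <-> q.1 = i.
Proof.
rewrite /ivoc /ivcc; split=> [[[h|[e|e]] _]|/cyc_next h].
- by move/ivoo_next: h => [k /point_inj ->].
- by case: (@a_notin i); rewrite -e; exact: point_in.
- by case: (@a_notin (ordS i)); rewrite -e; exact: point_in.
split; last by move=> e; apply: (@a_notin i); rewrite -e; exact: point_in.
by left; split=> //; apply: subset_closure; exact: point_in.
Qed.

Lemma a_neq_next i : a i <> a (ordS i).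
Proof. by case: enumA => inja _ _ /inja e; apply: (@ordS_neq _ i) => //; apply/eqP. Qed.

End ManyLimitPoints.

Definition entry_of i (l : level) : entry R := match l with
  | Low => Pt (a i)
  | Mid k => Pt (zpt (i, k))
  | High => if n == 1%N then RightEnd else Pt (a (ordS i)) end.

Lemma half_open_entry i (l : level) q :
  half_open Z a i (entry_of i l) (zpt q) <-> q.1 = i /\ below l q.2.
Proof.
case: l => [|k|] /=; first by rewrite ivoc_nil; split=> [[]|[]].
- exact: ivoc_point.
- have [n1|n1] := eqVneq n 1%N; last by rewrite /= ivoc_next //; split=> [|[]].
  split=> [_|_]; last exact: point_in.
  by split=> //; apply: val_inj => /=; have := ltn_ord i; have := ltn_ord q.1; lia.
Qed.

Lemma decorationP (P : {set {set 'I_n}}) (x : {ffun 'I_n -> entry R}) :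
  non_crossing P ->
  decoration Z a P x <-> exists L, (forall i, x i = entry_of i (L i)) /\ levels_ok P L.
Proof.
move=> ncP; split=> [dec|[L [xL okL]] i]; last first.
  rewrite xL; have [lowL highL] := okL i.
  case eL: (L i) => [|k|] /=.
  - case: eqP => [|n1]; first by right.
    rewrite /entry_range lowL //; split; first by right; left.
    by apply: a_neq_next; apply/eqP.
  - case: eqP => [n1|n1]; first by left; exact: point_in.
    have h : ivoo Z (a i) (a (ordS i)) (zpt (i, k)).
      by apply/ivoo_next; [exact/eqP|exists k].
    have na j : zpt (i, k) <> a j.
      by move=> e; apply: (@a_notin j); rewrite -e; exact: point_in.
    by rewrite /entry_range; case: ifP => _; [|case: ifP => _ //]; split=> //;
      [left|exact: na|left|exact: na].
  - case: (eqVneq n 1%N) => [//|n1].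
    have [e|adj] := highL eL; first by rewrite e in n1.
    rewrite /entry_range adj; case: ifP => [sing|_]; last first.
      by split; [right; right|move=> e; apply: (@a_neq_next n1 i)].
    (* With several limit points an adjacency is no singleton, because its block also contains
       [ordS i]. *)
    case/existsP: adj => B /and3P[PB iB siB].
    case: (@ordS_neq _ i); first exact/eqP.
    by rewrite -(singleton_block ncP PB sing iB siB).
suff /choice[L HL] : forall i, exists l, x i = entry_of i l /\
    (l = Low -> singleton P i) /\ (l = High -> n = 1%N \/ adjacency P i).
  by exists L; split=> i; have [? ?] := HL i.
move=> i; have := dec i; case: (x i) => [p|n1]; last first.
  by exists High; rewrite /= (introT eqP n1); split=> //; split=> // _; left.
case: (eqVneq n 1%N) => [n1 [Zp|->]|n1].
- have [[j k] ->] := point_surj Zp; exists (Mid k); split=> //=.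
  by congr (Pt (zpt _)); congr pair; apply: val_inj => /=;
    have := ltn_ord i; have := ltn_ord j; lia.
- exists Low; split=> //; split=> // _.
  have [/and3P[/eqP covP _ _] _] := ncP.
  have : i \in finset.cover P by rewrite covP finset.in_setT.
  case/finset.bigcupP=> B PB iB; rewrite /singleton.
  suff -> : [set i]%SET = B by [].
  apply/setP => j; rewrite finset.in_set1.
  have -> : j = i by apply: val_inj => /=; have := ltn_ord i; have := ltn_ord j; lia.
  by rewrite eqxx iB.
rewrite /entry_range; case: ifP => [sing|_].
  case=> -[h|[->|->]] ne; last by case: ne.
    by have [k ->] := (ivoo_next n1 i p).1 h; exists (Mid k).
  by exists Low.
case: ifP => [adj|_].
  case=> -[h|[->|->]] ne; first by have [k ->] := (ivoo_next n1 i p).1 h; exists (Mid k).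
    by case: ne.
  by exists High; rewrite /= (negbTE n1); split=> //; split=> // _; right.
by move=> /(ivoo_next n1 i p)[k ->]; exists (Mid k).
Qed.

End Coordinates.

(** * The cluster category in coordinates *)

(** Dimension at most one, phrased without a basis. *)
Definition at_most_line {K : fieldType} {C : linear_category K} (X Y : C) :=
  forall u v : Mor X Y, u <> 0 -> exists c, v = c *: u.

Section HomLines.
Context {K : fieldType} {C : linear_category K}.
Implicit Types X Y : C.

Lemma at_most_line_iso X Y Y' : isomorphic Y Y' -> at_most_line X Y -> at_most_line X Y'.
Proof.
move=> [f [g [gf fg]]] lineXY u v u0; have [|c e] := lineXY (g \oc u) (g \oc v).
  by move=> gu0; apply: u0; rewrite -[u]compose1m -fg -composeA gu0 compm0.
by exists c; rewrite -[v]compose1m -fg -composeA e compZr composeA fg compose1m.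
Qed.

Lemma scalar_line X Y (f : {scalar Mor X Y}) : bijective f -> at_most_line X Y.
Proof.
move=> /bij_inj injf u v u0; have fu0 : f u != 0.
  by apply/eqP => e; apply: u0; apply: injf; rewrite e linear0.
by exists (f v / f u); apply: injf; rewrite linearZ /= divfK.
Qed.

Lemma scalar_neq0 X Y (f : {scalar Mor X Y}) : bijective f -> exists u : Mor X Y, u <> 0.
Proof.
move=> [g gK fK]; exists (g 1) => e; have := fK 1; rewrite e linear0 => /eqP.
by rewrite eq_sym oner_eq0.
Qed.

Lemma neq0_iso X Y Y' : isomorphic Y Y' -> (exists u : Mor X Y, u <> 0) ->
  exists u : Mor X Y', u <> 0.
Proof.
move=> [f [g [gf fg]]] [u u0]; exists (f \oc u) => e; apply: u0.
by rewrite -[u]compose1m -gf -composeA e compm0.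
Qed.

End HomLines.

Lemma set2_eq {T : Type} (x y z w : T) : [set x; y] = [set z; w] ->
  x = z /\ y = w \/ x = w /\ y = z.
Proof.
move=> e.
have /= [h1 h2] : [set z; w] x /\ [set z; w] y by rewrite -e; split; [left|right].
have /= [h3 h4] : [set x; y] z /\ [set x; y] w by rewrite e; split; [left|right].
by case: h1 => h1; case: h2 => h2; case: h3 => h3; case: h4 => h4; subst; auto.
Qed.

Section Coordinatized.
Context {R : realType} {K : fieldType} {n : nat} (n_gt0 : (0 < n)%N).
Context (Z : set (plane R)) (admZ : admissible Z n).
Context (a : 'I_n -> plane R) (enumA : limit_enumeration Z a).
Context (C : triangle_data K) (E : set (plane R) -> C)
  (hC : discrete_cluster_category Z E).
Notation pt := ('I_n * int)%type.
Implicit Types (p q r s t u v y : pt).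

Local Notation zpt := (zpt n_gt0 Z a).
Let TC := dcc_triangulated hC.

Definition zarc p q : set (plane R) := [set zpt p; zpt q].
Local Notation ob p q := (E (zarc p q)).

Let injp := point_inj (n_gt0 := n_gt0) admZ enumA.

Lemma arcC p q : zarc p q = zarc q p.
Proof. exact: setUC. Qed.

Lemma arc_inj p q r s : zarc p q = zarc r s -> p = r /\ q = s \/ p = s /\ q = r.
Proof.
by move=> h; have [] := set2_eq h => -[e1 e2]; [left|right]; split; exact: injp.
Qed.

Lemma is_arc_points p q : is_arc Z (zarc p q) <-> carc p q.
Proof.
have nbr r s : ~ [set zpred Z (zpt r); zpt r; zsucc Z (zpt r)] (zpt s) <-> carc r s.
  rewrite (zpred_point n_gt0 admZ enumA) (zsucc_point n_gt0 admZ enumA).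
  split=> [h|/norP[/eqP h1 /norP[/eqP h2 /eqP h3]] /=].
    apply/norP; split; first by apply/eqP => e; apply: h; left; right; rewrite e.
    apply/norP; split; apply/eqP => e; apply: h; rewrite e; [by right|by left; left].
  by case=> [[|]|] /injp.
split=> [[z0 [z1 [Z0 Z1 h e]]]|h].
  have [r er] := point_surj n_gt0 admZ enumA Z0.
  have [s es] := point_surj n_gt0 admZ enumA Z1; subst z0 z1.
  by move/nbr: h; case/arc_inj: e => -[-> ->] //; rewrite carc_sym.
by exists (zpt p), (zpt q); split=> //; [exact: point_in|exact: point_in|exact/nbr].
Qed.

Lemma is_arcP A : is_arc Z A -> exists p q, A = zarc p q /\ carc p q.
Proof.
move=> arcA; have [z0 [z1 [Z0 Z1 _ eA]]] := arcA.
have [r er] := point_surj n_gt0 admZ enumA Z0.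
have [s es] := point_surj n_gt0 admZ enumA Z1; subst z0 z1.
by exists r, s; rewrite eA; split=> //; apply/is_arc_points; rewrite /zarc -eA.
Qed.

Lemma cyc4_points p q r s : cyc4 (zpt p) (zpt q) (zpt r) (zpt s) <-> ccyc4 p q r s.
Proof.
rewrite /cyc4; split=> [[/(cyc_point n_gt0 admZ enumA) pqr _ /(cyc_point n_gt0 admZ enumA) rsp _]|].
  exact/andP.
move=> h; have h1 := ccyc4_rot h; have h2 := ccyc4_rot h1; have h3 := ccyc4_rot h2.
by split; apply/(cyc_point n_gt0 admZ enumA);
  [case/andP: h|case/andP: h1|case/andP: h2|case/andP: h3].
Qed.

Lemma crossing_points p q r s :
  crossing (zpt p) (zpt q) (zpt r) (zpt s) <-> ccross p q r s.
Proof.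
by split=> [[/cyc4_points|/cyc4_points]|/orP[/cyc4_points|/cyc4_points]] h;
  [apply/orP; left|apply/orP; right|left|right].
Qed.

Lemma susp_arc p q : carc p q ->
  isomorphic (susp (ob p q)) (ob (shp (-1) p) (shp (-1) q)).
Proof.
move=> /is_arc_points/(dcc_susp hC).
by rewrite !(zpred_point n_gt0 admZ enumA).
Qed.

Lemma desusp_arc p q : carc p q ->
  isomorphic (susp (ob (shp 1 p) (shp 1 q))) (ob p q).
Proof.
rewrite -(carc_shift 1) => /susp_arc.
by rewrite !shpD addrC subrr !shp0.
Qed.

Lemma ext_line p q r s : carc p q -> carc r s ->
  at_most_line (ob p q) (susp (ob r s)).
Proof.
move=> /is_arc_points pq /is_arc_points rs.
have [c|nc] := pselect (crossing (zpt p) (zpt q) (zpt r) (zpt s)).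
  by have [f] := dcc_hom1 hC pq rs c; exact: scalar_line.
by move=> u v; case; exact: (dcc_hom0 hC pq rs nc u).
Qed.

Lemma ext_neq0 p q r s : carc p q -> carc r s ->
  ccross p q r s <-> exists f : Mor (ob p q) (susp (ob r s)), f <> 0.
Proof.
move=> /is_arc_points pq /is_arc_points rs; split.
  by move=> /crossing_points/(dcc_hom1 hC pq rs)[f]; exact: scalar_neq0.
move=> [f f0]; apply: contrapT => nc; apply: f0.
by apply: (dcc_hom0 hC pq rs) => /crossing_points.
Qed.

(** The target is the suspension of the arc shifted by +1, which reduces Hom to Ext; likewise in
    [hom_neq0]. *)
Lemma hom_line p q r s : carc p q -> carc r s -> at_most_line (ob p q) (ob r s).
Proof.
move=> pq rs; apply: at_most_line_iso (desusp_arc rs) _.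
by apply: ext_line => //; rewrite carc_shift.
Qed.

Lemma hom_neq0 p q r s : carc p q -> carc r s ->
  ccross p q (shp 1 r) (shp 1 s) <-> exists f : Mor (ob p q) (ob r s), f <> 0.
Proof.
move=> pq rs; have iso := desusp_arc rs.
have rs' : carc (shp 1 r) (shp 1 s) by rewrite carc_shift.
split=> [/(ext_neq0 pq rs')|h]; first exact: neq0_iso.
by apply/(ext_neq0 pq rs')/neq0_iso/h/isomorphic_sym.
Qed.

Lemma factor_points p q r s u v (f : Mor (ob p q) (ob r s)) : carc p q -> carc r s ->
  carc u v -> ccyc4 p (shp 1 r) q (shp 1 s) -> f <> 0 -> cin p u r -> cin q v s ->
  exists (g : Mor (ob u v) (ob r s)) (h : Mor (ob p q) (ob u v)), f = g \oc h.
Proof.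
move=> /is_arc_points pq /is_arc_points rs /is_arc_points uv /cyc4_points.
rewrite -!(zsucc_point n_gt0 admZ enumA) => c f0 pu qv.
apply/(dcc_factor hC pq rs c f0 uv); exists (zpt u), (zpt v).
by split=> //; apply/(ivcc_point n_gt0 admZ enumA).
Qed.

Lemma factor_pointsP p q r s (f : Mor (ob p q) (ob r s)) A
    (g : Mor (E A) (ob r s)) (h : Mor (ob p q) (E A)) : carc p q -> carc r s ->
  is_arc Z A -> ccyc4 p (shp 1 r) q (shp 1 s) -> f <> 0 -> f = g \oc h ->
  exists u v, [/\ A = zarc u v, cin p u r & cin q v s].
Proof.
move=> /is_arc_points pq /is_arc_points rs arcA /cyc4_points.
rewrite -!(zsucc_point n_gt0 admZ enumA) => c f0 fgh.
have [|s0 [s1 [eA h0 h1]]] := (dcc_factor hC pq rs c f0 arcA).1; first by exists g, h.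
(* The axiom places [s0] and [s1] only in the closure of [Z]; being endpoints of the arc [A], they
   have coordinates. *)
have [u' [v' [eA' _]]] := is_arcP arcA.
have [u eu] : exists u, s0 = zpt u.
  by have : A s0; [rewrite eA; left|rewrite eA' => -[]->; [exists u'|exists v']].
have [v ev] : exists v, s1 = zpt v.
  by have : A s1; [rewrite eA; right|rewrite eA' => -[]->; [exists u'|exists v']].
subst s0 s1; exists u, v.
by split=> //; apply/(ivcc_point n_gt0 admZ enumA).
Qed.

Lemma arc_nonzero p q : carc p q -> ~ is_zero (ob p q).
Proof. by move=> /is_arc_points/(dcc_indec hC)[]. Qed.

Lemma indecomposable_arc S : indecomposable S ->
  exists p q, carc p q /\ isomorphic (ob p q) S.
Proof.
move=> /(dcc_indec_arc hC)[A arcA iso]; have [p [q [eA pq]]] := is_arcP arcA.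
by exists p, q; rewrite -eA.
Qed.

Lemma arc_decomposition S : exists (m : nat) (X : 'I_m -> C) (pq : 'I_m -> pt * pt),
  direct_sum X S /\
  forall k, carc (pq k).1 (pq k).2 /\ isomorphic (ob (pq k).1 (pq k).2) (X k).
Proof.
have [m [X [sX locX]]] := dcc_krull_schmidt hC S; exists m, X.
have /choice[pq pqP] : forall k, exists pq : pt * pt,
    carc pq.1 pq.2 /\ isomorphic (ob pq.1 pq.2) (X k).
  move=> k; have [p [q [arc_pq iso]]] := indecomposable_arc (local_indecomposable (locX k)).
  by exists (p, q).
by exists pq.
Qed.

End Coordinatized.

(** * Decorated partitions and t-structures *)

Section Correspondence.
Context {R : realType} {K : fieldType} {n : nat} (n_gt0 : (0 < n)%N).
Context (Z : set (plane R)) (admZ : admissible Z n).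
Context (a : 'I_n -> plane R) (enumA : limit_enumeration Z a).
Context (C : triangle_data K) (E : set (plane R) -> C)
  (hC : discrete_cluster_category Z E).
Notation pt := ('I_n * int)%type.
Implicit Types (p q r s t u v y : pt) (P : {set {set 'I_n}}).

Local Notation zarc := (zarc n_gt0 Z a).
Local Notation ob p q := (E (zarc p q)).
Let TC := dcc_triangulated hC.

Let obC p q : ob p q = ob q p.
Proof. by rewrite arcC. Qed.

Definition arcs_of P L : set C := [set X | exists p q, xarc P L p q /\ X = ob p q].

(** * From decorated partitions to t-structures *)

Section Existence.
Context (P : {set {set 'I_n}}) (L : 'I_n -> level).
Hypotheses (ncP : non_crossing P) (okL : levels_ok P L).

Section OneBlock.
Context (B : {set 'I_n}) (PB : B \in P) (t0 t1 : pt) (t01 : carc t0 t1).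

(** The second clause keeps blocks apart: when the approximations of all blocks are added, a map
    from an arc of one block has no component in the suspended summands of the others. *)
Definition good_block (X : C) (f : Mor X (ob t0 t1)) :=
  (forall y0 y1, carc y0 y1 -> region L B y0 -> region L B y1 ->
    (forall g : Mor (ob y0 y1) (ob t0 t1), exists g', g = f \oc g') /\
    (forall h : Mor (ob y0 y1) (susp X), suspm f \oc h = 0 -> h = 0)) /\
  (forall B' y0 y1, B' \in P -> B' != B -> carc y0 y1 ->
    region L B' y0 -> region L B' y1 ->
    forall h : Mor (ob y0 y1) (susp X), h = 0).

Let hom_cases y0 y1 : carc y0 y1 ->
  (exists g : Mor (ob y0 y1) (ob t0 t1), g <> 0) ->
  cin (shp 2 t1) y0 t0 && cin (shp 2 t0) y1 t1 \/
  cin (shp 2 t1) y1 t0 && cin (shp 2 t0) y0 t1.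
Proof.
move=> y01 /(hom_neq0 n_gt0 admZ enumA hC y01 t01)/orP[/(hom_cin t01) h|h]; first by left.
by right; apply: (hom_cin t01); exact: ccyc4_rot (ccyc4_rot h).
Qed.

(** If the block does not meet both windows, it has no non-zero map to the arc, and a zero object
    does. *)
Lemma block_approximation_zero :
  (forall p q, region L B p -> region L B q ->
    cin (shp 2 t1) p t0 -> cin (shp 2 t0) q t1 -> False) ->
  exists (X : C) (f : Mor X (ob t0 t1)), add_closure (arcs_of P L) X /\ good_block f.
Proof.
move=> none; have [Q Q0] := has_zero TC; exists Q, 0; split.
  by apply: sub_zero Q0; exact: is_subcategory_add_closure.
have z Y (h : Mor Y (susp Q)) : h = 0 by apply: zero_target; exact: is_zero_susp.
split=> [y0 y1 y01 B0 B1|B' y0 y1 *]; last exact: z.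
split=> [g|h _]; last exact: z.
exists 0; rewrite compm0; apply: contrapT => g0.
have [|/andP[]|/andP[]] := @hom_cases y0 y1 y01; first by exists g.
  exact: none.
exact: none.
Qed.

Section Nonzero.
Context (s0 s1 : pt).
Hypotheses (Bs0 : region L B s0) (Bs1 : region L B s1)
  (s0in : cin (shp 2 t1) s0 t0) (s1in : cin (shp 2 t0) s1 t1)
  (max0 : forall p, region L B p -> cin (shp 2 t1) p t0 -> cin (shp 2 t1) p s0)
  (max1 : forall p, region L B p -> cin (shp 2 t0) p t1 -> cin (shp 2 t0) p s1).

Let s01 : carc s0 s1 := cin_carc t01 s0in s1in.

Context (f : Mor (ob s0 s1) (ob t0 t1)) (f0 : f <> 0).

(** Maximality puts [s0], [s1] between the endpoints of source and target, so [g] factors through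
    [{s0, s1}]; its second factor is a multiple of [f]. *)
Let lift_oriented y0 y1 (g : Mor (ob y0 y1) (ob t0 t1)) : carc y0 y1 ->
  region L B y0 -> region L B y1 -> g <> 0 ->
  cin (shp 2 t1) y0 t0 -> cin (shp 2 t0) y1 t1 -> exists g', g = f \oc g'.
Proof.
move=> y01 B0 B1 g0 yt0 yt1.
have ys0 : cin y0 s0 t0 by exact: cin_trans_right (max0 B0 yt0) s0in.
have ys1 : cin y1 s1 t1 by exact: cin_trans_right (max1 B1 yt1) s1in.
have [g1 [h1 ->]] := factor_points admZ enumA hC y01 t01 s01
  (cin_hom t01 yt0 yt1) g0 ys0 ys1.
have [c ->] := hom_line admZ enumA hC s01 t01 g1 f0.
by exists (c *: h1); rewrite compZl compZr.
Qed.

(** A non-zero [phi] from [{y0, y1}] to the suspension of [{t0, t1}] factors through the suspension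
    of [{s0, s1}]. Up to scalars the factors are [h] and [suspm f], so [suspm f \oc h = 0] would
    kill [phi]. *)
Let susp_inj_oriented y0 y1 (h : Mor (ob y0 y1) (susp (ob s0 s1))) : carc y0 y1 ->
  region L B y0 -> region L B y1 -> ccyc4 y0 s0 y1 s1 -> suspm f \oc h = 0 -> h = 0.
Proof.
move=> y01 B0 B1 ys fh0; apply: contrapT => h0.
have propagate := cross_propagate t01 s0in s1in (max0 B1) (max1 B0) ys.
have between0 := cross_between0 t01 s0in s1in (max0 B1) (max1 B0) ys.
have between1 := cross_between1 t01 s0in s1in (max0 B1) (max1 B0) ys.
have t01' : carc (shp (-1) t0) (shp (-1) t1) by rewrite carc_shift.
have s01' : carc (shp (-1) s0) (shp (-1) s1) by rewrite carc_shift.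
have up t : shp 1 (shp (-1) t) = t by rewrite shpD addrC subrr shp0.
have [phi phi0] : exists phi : Mor (ob y0 y1) (ob (shp (-1) t0) (shp (-1) t1)), phi <> 0.
  by apply/(hom_neq0 n_gt0 admZ enumA hC y01 t01'); rewrite !up /ccross propagate.
have [|be [al e]] := factor_points admZ enumA hC y01 t01' s01' _ phi0 between0 between1.
  by rewrite !up.
have [v [v' [v'v vv']]] := susp_arc n_gt0 admZ enumA hC s01.
have [w [w' [w'w ww']]] := susp_arc n_gt0 admZ enumA hC t01.
(* Conjugated by the isomorphisms of [susp_arc], [be] becomes a map between suspensions, which can
   be desuspended and compared with [f]. *)
have [be' ebe] := susp_full TC (w' \oc be \oc v).
have [c ec] := hom_line admZ enumA hC s01 t01 be' f0.
have [d ed] := ext_line admZ enumA hC y01 s01 (v' \oc al) h0.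
apply: phi0; rewrite e -[be]compose1m -ww' -composeA -[al]compose1m -vv' -!composeA.
rewrite ed (composeA be v) (composeA w') (composeA w') -ebe ec (suspZ TC).
by rewrite compZl !compZr fh0 compm0 !scaler0.
Qed.

Lemma block_approximation_nonzero : good_block f.
Proof.
split=> [y0 y1 y01 B0 B1|B' y0 y1 PB' BB' y01 B0 B1 h]; last first.
  apply: contrapT => h0; have : ccross y0 y1 s0 s1.
    by apply/(ext_neq0 n_gt0 admZ enumA hC y01 s01); exists h.
  by apply/negP; exact: (region_noncrossing ncP PB' PB BB' B0 B1 Bs0 Bs1).
have y10 : carc y1 y0 by rewrite carc_sym.
split=> [g|h fh0].
  have [->|g0] := pselect (g = 0); first by exists 0; rewrite compm0.
  have [|/andP[]|/andP[]] := @hom_cases y0 y1 y01; first by exists g.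
    exact: lift_oriented.
  by move: g g0; rewrite obC => g g0; exact: lift_oriented.
have [//|h0] := pselect (h = 0).
have /orP[c|c] : ccross y0 y1 s0 s1.
  by apply/(ext_neq0 n_gt0 admZ enumA hC y01 s01); exists h.
  exact: susp_inj_oriented c fh0.
have {}c : ccyc4 y1 s0 y0 s1 by exact: ccyc4_rot (ccyc4_rot c).
by move: h fh0 {h0}; rewrite obC => h fh0; exact: susp_inj_oriented c fh0.
Qed.

End Nonzero.

Lemma block_approximation :
  exists (X : C) (f : Mor X (ob t0 t1)), add_closure (arcs_of P L) X /\ good_block f.
Proof.
have [[p0 p0P]|none] := pselect (exists p, region L B p && cin (shp 2 t1) p t0); last first.
  apply: block_approximation_zero => p q Bp _ pt _; apply: none.
  by exists p; rewrite Bp.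
have [[p1 p1P]|none] := pselect (exists p, region L B p && cin (shp 2 t0) p t1); last first.
  apply: block_approximation_zero => p q _ Bq _ qt; apply: none.
  by exists q; rewrite Bq.
have [s0 [Bs0 s0in max0]] := region_max ncP okL PB (ex_intro _ p0 p0P).
have [s1 [Bs1 s1in max1]] := region_max ncP okL PB (ex_intro _ p1 p1P).
have s01 := cin_carc t01 s0in s1in.
have [f f0] : exists f : Mor (ob s0 s1) (ob t0 t1), f <> 0.
  apply/(hom_neq0 n_gt0 admZ enumA hC s01 t01).
  by rewrite /ccross (cin_hom t01 s0in s1in).
exists (ob s0 s1), f; split; last exact: (block_approximation_nonzero Bs0 Bs1).
apply: sub_add_closure; exists s0, s1; split=> //; split=> //.
by exists B; rewrite ?Bs0.
Qed.

End OneBlock.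

Lemma approximable_arc t0 t1 : carc t0 t1 -> approximable (arcs_of P L) (ob t0 t1).
Proof.
move=> t01; pose blk (k : 'I_#|P|) : {set 'I_n} := enum_val k.
have Pblk k : blk k \in P := enum_valP k.
have /choice[X appX] : forall k, exists (X : C), exists (f : Mor X (ob t0 t1)),
    add_closure (arcs_of P L) X /\ good_block (blk k) f.
  by move=> k; exact: block_approximation.
pose f k := projT1 (cid (appX k)).
have appf k : add_closure (arcs_of P L) (X k) /\ good_block (blk k) (f k).
  exact: projT2 (cid (appX k)).
have [SX sumX] := direct_sum_exists TC X; have [i [p [pi pi0 ip]]] := sumX.
have fi k : (\sum_j f j \oc p j) \oc i k = f k.
  rewrite comp_suml (bigD1 k) //= -composeA pi composem1 big1 ?addr0 // => j jk.
  by rewrite -composeA pi0 // compm0.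
exists SX, (\sum_k f k \oc p k); split.
  by apply: (is_subcategory_add_closure _).1 sumX _ => k; case: (appf k).
move=> _ [y0 [y1 [[y01 [B PB /andP[B0 B1]]] ->]]].
pose k0 : 'I_#|P| := enum_rank_in PB B.
have ek0 : blk k0 = B by rewrite /blk enum_rankK_in.
have [_ [/(_ y0 y1 y01)]] := appf k0; rewrite ek0 => /(_ B0 B1)[lift inj] _.
split=> [g|h h0].
  by have [g' ->] := lift g; exists (i k0 \oc g'); rewrite composeA fi.
(* Arcs of distinct blocks do not cross, so [h] is concentrated in the summand of its own block,
   where [inj] applies. *)
have other k : k != k0 -> suspm (p k) \oc h = 0.
  move=> kk0; have [_ [_ none]] := appf k; apply: (none B) => //.
  by rewrite -ek0 (inj_eq enum_val_inj) eq_sym.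
have hE : h = suspm (i k0) \oc (suspm (p k0) \oc h).
  rewrite -[LHS]compose1m -(suspm_id TC) -ip (susp_sum TC) comp_suml (bigD1 k0) //=.
  rewrite (suspm_comp TC) -composeA big1 ?addr0 // => k /other hk.
  by rewrite (suspm_comp TC) -composeA hk compm0.
have : suspm (p k0) \oc h = 0.
  by apply: inj; rewrite -[RHS]h0 [in RHS]hE [in RHS]composeA -(suspm_comp TC) fi.
by move=> ph0; rewrite hE ph0 compm0.
Qed.

Lemma arcs_of_approximable T : approximable (arcs_of P L) T.
Proof.
have [m [X [pq [sumX XP]]]] := arc_decomposition n_gt0 admZ enumA hC T.
apply: (approximable_direct_sum TC sumX) => k; have [arc_pq iso] := XP k.
exact: (approximable_iso TC iso (approximable_arc arc_pq)).
Qed.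

Lemma arcs_of_susp X : arcs_of P L X -> add_closure (arcs_of P L) (susp X).
Proof.
move=> [p [q [[pq [B PB /andP[Bp Bq]]] ->]]].
apply: (sub_iso (is_subcategory_add_closure _) (susp_arc n_gt0 admZ enumA hC pq)).
apply: sub_add_closure; exists (shp (-1) p), (shp (-1) q); split=> //.
split; first by rewrite carc_shift.
by exists B => //; rewrite !(region_shp (k := 1)).
Qed.

Lemma t_structure_arcs_of :
  t_structure (add_closure (arcs_of P L)) (right_perp (add_closure (arcs_of P L))).
Proof. exact: (t_structure_add_closure TC arcs_of_approximable arcs_of_susp). Qed.

Lemma arcs_of_ob p q : carc p q -> add_closure (arcs_of P L) (ob p q) -> xarc P L p q.
Proof.
move=> pq addpq; apply: contrapT => nX; apply: (arc_nonzero admZ enumA hC pq).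
(* [null] is a subcategory. If [{p, q}] were not an arc of the partition, it would contain all
   generators, hence [ob p q], whose identity would then vanish. *)
pose null := [set X : C | forall (g : Mor X (ob p q)) (h : Mor (ob p q) X), g \oc h = 0].
suff : null (ob p q) by move=> /(_ (idm _) (idm _)); rewrite compose1m.
apply: addpq.
  split=> [m X S [i [r [_ _ ir]]] nullX g h|X Y S [i [_ [r [_ [ri _ _ _ _]]]]] nullS g h].
    rewrite -(compose1m h) -ir comp_suml comp_sumr big1 // => k _.
    by rewrite -composeA composeA nullX.
  by rewrite -(compose1m h) -ri -composeA composeA nullS.
move=> _ [u [v [uv ->]]] g h; apply: contrapT => gh0.
have [u' [v' [e cu cv]]] := factor_pointsP admZ enumA hC pq pq
  ((is_arc_points n_gt0 admZ enumA u v).2 uv.1) (ccyc4_self pq) gh0 erefl.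
move: e; rewrite (cin_self cu) (cin_self cv) => /(arc_inj admZ enumA)[[eu ev]|[eu ev]].
  by apply: nX; rewrite -eu -ev.
apply: nX; rewrite -eu -ev; have [vu [B PB Buv]] := uv.
by split; [rewrite carc_sym|exists B; rewrite // andbC].
Qed.

End Existence.

Lemma add_closure_inj P P' L L' : non_crossing P -> non_crossing P' ->
  levels_ok P L -> levels_ok P' L' ->
  add_closure (arcs_of P L) = add_closure (arcs_of P' L') -> P = P' /\ L =1 L'.
Proof.
move=> ncP ncP' okL okL' eG; apply: xarc_inj => // p q; split=> h.
  apply: arcs_of_ob (h.1) _; rewrite -eG; apply: sub_add_closure.
  by exists p, q.
apply: arcs_of_ob (h.1) _; rewrite eG; apply: sub_add_closure.
by exists p, q.
Qed.

(** * From t-structures to decorated partitions *)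

Section Aisles.
Context (U V : set C) (UV : t_structure U V).

Let tpUV : torsion_pair U V := UV.1.
Let subU : is_subcategory U. Proof. by case: tpUV. Qed.

Let X p q := carc p q /\ U (ob p q).

(** A non-zero extension of the crossing arcs has [{p, r}] as a summand of its middle term, and
    aisles are closed under extensions and summands. *)
Let X_ext_oriented p q r s : X p q -> X r s -> ccyc4 p r q s -> carc p r -> X p r.
Proof.
move=> [pq Upq] [rs Urs] c pr; split=> //.
have /(is_arc_points n_gt0 admZ enumA) Apq := pq.
have /(is_arc_points n_gt0 admZ enumA) Ars := rs.
have [f f0] : exists f : Mor (ob p q) (susp (ob r s)), f <> 0.
  by apply/(ext_neq0 n_gt0 admZ enumA hC pq rs); rewrite /ccross c.
have /(cyc4_points n_gt0 admZ enumA) c4 := c.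
have [M [i1 [i2 [p1 [p2 [u [v [bip tri _ _]]]]]]]] := dcc_triangle hC Apq Ars c4 f0.
apply: (subU.2 _ _ M); first by exists i1, i2, p1, p2.
exact: (torsion_pair_extension TC tpUV tri Urs Upq).
Qed.

Let Xsym p q : X p q -> X q p.
Proof. by move=> [pq Upq]; split; rewrite 1?carc_sym // obC. Qed.

Let Xext p q r s : X p q -> X r s -> ccross p q r s -> carc p r -> X p r.
Proof.
move=> pq rs /orP[c|c] pr; first exact: X_ext_oriented pq rs c pr.
apply: Xsym; apply: (X_ext_oriented rs pq); last by rewrite carc_sym.
exact: ccyc4_rot (ccyc4_rot (ccyc4_rot c)).
Qed.

Let Xshift p q : X p q -> X (shp (-1) p) (shp (-1) q).
Proof.
move=> [pq Upq]; split; first by rewrite carc_shift.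
by apply: (sub_iso subU _ (UV.2 _ Upq)); apply/isomorphic_sym/(susp_arc n_gt0 admZ enumA hC pq).
Qed.

Let Xarc p q : X p q -> carc p q.
Proof. by case. Qed.

Lemma aisle_next (i : 'I_n) : n <> 1%N -> (forall k, exists q, X (i, k) q) ->
  i <> ordS i /\ exists k l, X (i, k) (ordS i, l).
Proof.
move=> n1 cov; have iS : i <> ordS i by apply/nesym/ordS_neq.
split=> //; apply: contrapT => nl.
pose t0 : pt := (i, 0); pose t1 : pt := (ordS i, 0).
have t01 : carc t0 t1 by exact: carc_lines.
have [_ _ hom0 tri] := tpUV.
have [X0 [Y0 [f [g [h [UX0 VY0 fgh]]]]]] := tri (ob t0 t1).
have [m [Y [pq [sumY YP]]]] := arc_decomposition n_gt0 admZ enumA hC X0.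
have Xpq k : X (pq k).1 (pq k).2.
  have [arc_pq iso] := YP k; split=> //; apply: (sub_iso subU iso).
  by have [j [p pj]] := direct_sum_summand k sumY; exact: (sub_retract TC subU pj UX0).
(* [N] exceeds the second coordinates of the finitely many arcs of the
   approximation, so a map from [{(i, 0), (i, N)}] can factor only through an arc
   reaching the next segment. *)
have /choice[b bP] : forall k, exists b : int, forall l,
    zarc (i, 0) (i, l) = zarc (pq k).1 (pq k).2 -> l <= b.
  move=> k; have [[l0 <-]|none] := pselect (exists l,
      zarc (i, 0) (i, l) = zarc (pq k).1 (pq k).2); last first.
    by exists 0 => l e; case: none; exists l.
  by exists l0 => l /(arc_inj admZ enumA)[[_ [->]]|[[<-] [->]]].
pose N : int := 3 + (\sum_k absz (b k))%:Z.
have bN k : b k < N.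
  have : (absz (b k) <= \sum_j absz (b j))%N by rewrite (bigD1 k) //= leq_addr.
  by rewrite /N; lia.
(* This places [(i, N)] beyond [t0^++ = (i, 2)], so that [{(i, 0), (i, N)}] is an arc with a
   non-zero map to [{t0, t1}]. *)
have N2 : 2 < N by rewrite /N; lia.
have Xi : X (i, 0) (i, N).
  by apply/Xsym/(ptolemy_line Xsym Xarc Xshift Xext (cov N)); rewrite ?subr_ge0 //; lia.
have y01 := Xarc Xi.
have cross4 : ccyc4 (i, 0) (shp 1 t0) (i, N) (shp 1 t1).
  by apply: (cin_hom t01); [rewrite /cin eqxx !orbT|exact: cin_before_next].
have [phi phi0] : exists phi : Mor (ob (i, 0) (i, N)) (ob t0 t1), phi <> 0.
  by apply/(hom_neq0 n_gt0 admZ enumA hC y01 t01); rewrite /ccross cross4.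
have Ui : U (ob (i, 0) (i, N)) by case: Xi.
have [phi' ephi] : exists phi', phi = f \oc phi'.
  apply: (dist_lift TC fgh); apply: (hom0 _ _ Ui VY0).
have [ji [p [_ _ ip]]] := sumY.
have [k psi0] : exists k, f \oc ji k \oc (p k \oc phi') <> 0.
  apply: contrapT => /forallNP none; apply: phi0.
  rewrite ephi -(compose1m phi') -ip comp_suml comp_sumr big1 // => k _.
  by have := none k; rewrite notK -!composeA.
have [arc_pq [w [w' [w'w ww']]]] := YP k.
have Apq := (is_arc_points n_gt0 admZ enumA _ _).2 arc_pq.
have epsi : f \oc ji k \oc (p k \oc phi') = (f \oc ji k \oc w) \oc (w' \oc (p k \oc phi')).
  by rewrite -!composeA (composeA w) ww' compose1m.
have [u [v [e cu cv]]] := factor_pointsP admZ enumA hC y01 t01 Apq cross4 psi0 epsi.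
(* Source and target share the endpoint [(i, 0)], so the intermediate arc has it too; only [v] is
   left to locate. *)
rewrite (cin_self cu) in e; have Xv : X (i, 0) v.
  by have := Xpq k; case/(arc_inj admZ enumA): e => -[-> ->] //; exact: Xsym.
have [vS|[vi Nv]] := cin_next n1 cv.
  by apply: nl; exists 0, v.2; rewrite -vS -surjective_pairing.
have := bP k v.2; rewrite e -[in X in X -> _]vi -surjective_pairing => /(_ erefl) vb.
by have := bN k; rewrite ltNge (le_trans Nv vb).
Qed.

Lemma aisle_shape : exists P L, [/\ non_crossing P, levels_ok P L
  & forall p q, X p q <-> xarc P L p q].
Proof. exact: (ptolemy_shape Xsym Xarc Xshift Xext aisle_next). Qed.

Lemma aisle_add_closure P L : (forall p q, X p q <-> xarc P L p q) ->
  U = add_closure (arcs_of P L).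
Proof.
move=> XP; rewrite eqEsubset; split=> T; last first.
  by apply=> // _ [p [q [/XP[_ Upq] ->]]].
move=> UT; have [m [Y [pq [sumY YP]]]] := arc_decomposition n_gt0 admZ enumA hC T.
apply: ((is_subcategory_add_closure _).1 _ _ _ sumY) => k; have [arc_pq iso] := YP k.
apply: (sub_iso (is_subcategory_add_closure _) (isomorphic_sym iso)).
apply: sub_add_closure; exists (pq k).1, (pq k).2; split=> //; apply/XP; split=> //.
apply: (sub_iso subU iso); have [i [p pi]] := direct_sum_summand k sumY.
exact: (sub_retract TC subU pi UT).
Qed.

End Aisles.

Lemma aisle_arcsE P (x : {ffun 'I_n -> entry R}) L :
  (forall i, x i = entry_of n_gt0 Z a i (L i)) -> E @` aisle_arcs Z a P x = arcs_of P L.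
Proof.
move=> xL; rewrite eqEsubset; split=> [_ [A [arcA [B PB AB]] <-]|_ [p [q [[pq [B PB Bpq]] ->]]]].
  have [p [q [eA pq]]] := is_arcP n_gt0 admZ enumA arcA; exists p, q; rewrite -eA.
  split=> //; split=> //; exists B => //.
  have inB r : A (zpt n_gt0 Z a r) -> region L B r.
    move=> /AB[i /= iB]; rewrite xL => /(half_open_entry n_gt0 admZ enumA)[ri rL].
    by rewrite /region ri iB.
  by rewrite !inB // eA; [right|left].
exists (zarc p q) => //; split; first by apply/(is_arc_points n_gt0 admZ enumA).
have inB r : region L B r -> (\bigcup_(i in [set` B]) half_open Z a i (x i)) (zpt n_gt0 Z a r).
  move=> /andP[rB rL]; exists r.1 => //.
  by rewrite xL; apply/(half_open_entry n_gt0 admZ enumA).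
by exists B => // _ [] ->; apply: inB; case/andP: Bpq.
Qed.

Definition t_structure_of (Px : {set {set 'I_n}} * {ffun 'I_n -> entry R}) : set C * set C :=
  let U := add_closure (E @` aisle_arcs Z a Px.1 Px.2) in (U, right_perp U).

Lemma t_structure_of_bij :
  set_bij (decorated_ncp Z a) [set UV | t_structure UV.1 UV.2] t_structure_of.
Proof.
split.
- move=> [P x] [/= ncP /(decorationP n_gt0 admZ enumA x ncP)[L [xL okL]]] /=.
  by rewrite (aisle_arcsE P xL); exact: t_structure_arcs_of.
- move=> [P x] [P' x'] /set_mem[/= ncP decx] /set_mem[/= ncP' decx'].
  have [L [xL okL]] := (decorationP n_gt0 admZ enumA x ncP).1 decx.
  have [L' [xL' okL']] := (decorationP n_gt0 admZ enumA x' ncP').1 decx'.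
  rewrite /t_structure_of /= (aisle_arcsE P xL) (aisle_arcsE P' xL') => -[eU _].
  have [-> eL] := add_closure_inj ncP ncP' okL okL' eU.
  by congr pair; apply/ffunP => i; rewrite xL xL' eL.
- move=> [U V] /= UV; have [P [L [ncP okL XP]]] := aisle_shape UV.
  pose x : {ffun 'I_n -> entry R} := [ffun i => entry_of n_gt0 Z a i (L i)].
  have xL i : x i = entry_of n_gt0 Z a i (L i) by rewrite ffunE.
  exists (P, x).
    by split=> //=; apply/(decorationP n_gt0 admZ enumA x ncP); exists L.
  rewrite /t_structure_of /= (aisle_arcsE P xL) -(aisle_add_closure UV XP).
  by rewrite -(torsion_pair_right TC UV.1).
Qed.

End Correspondence.

Theorem theorem1p1 (R : realType) (K : fieldType) (n : nat) (hn : (1 <= n)%N)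
    (Z : set (plane R)) (hZ : admissible Z n)
    (a : 'I_n -> plane R) (ha : limit_enumeration Z a)
    (C : triangle_data K) (E : set (plane R) -> C)
    (hC : discrete_cluster_category Z E) :
  exists F : {set {set 'I_n}} * {ffun 'I_n -> entry R} -> set C * set C,
    set_bij (decorated_ncp Z a) [set UV | t_structure UV.1 UV.2] F /\
    forall (P : {set {set 'I_n}}) (x : {ffun 'I_n -> entry R}),
      decorated_ncp Z a (P, x) ->
      (F (P, x)).1 = add_closure (E @` aisle_arcs Z a P x).
Proof.
exists (t_structure_of Z a E); split; last by [].
exact: (t_structure_of_bij hn hZ ha hC).
Qed.
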